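(* Let $K$ be a non-Archimedean local field with residue field of cardinality $q$, and let $\varphi:K\to\mathbb C$ satisfy $\varphi\in L^\infty_{\mathrm{loc}}(K)$ and $\varphi(t)=O(|t|_K^{-\beta})$ as $|t|_K\to\infty$ for some $\beta>1$. Then $$ \left\|D^1_\varepsilon(D^{-1}\varphi)-\varphi\right\|_{L^1(K)}\longrightarrow 0\quad\text{as } \varepsilon=q^{-\nu}\to 0\ (\nu\in\mathbb N,\ \nu\to\infty). $$
   Context: $K$ is a non-Archimedean local field (a non-discrete totally disconnected locally compact topological field) with normalized absolute value $|\cdot|_K$: if $O=\{x\in K:|x|_K\le 1\}$, $P=\{x\in K:|x|_K<1\}=\pi O$, and $q$ is the cardinality of the finite residue field $O/P$, then $|\pi|_K=q^{-1}$. $dx$ is the Haar measure on the additive group of $K$ normalized so that $O$ has measure $1$. $\log$ is the natural logarithm. $L^\infty_{\mathrm{loc}}(K)$ denotes the measurable functions essentially bounded on every compact subset of $K$. The logarithmic Riesz potential is $$(D^{-1}\varphi)(x)=d_1\int_K\log|x-y|_K\,\varphi(y)\,dy,\qquad d_1=\frac{1-q}{q\log q},$$ and the truncated fractional differentiation operator of order $1$ is $$(D^1_\varepsilon u)(x)=c_1\int_{|y-x|_K\ge\varepsilon}\frac{u(y)-u(x)}{|y-x|_K^{2}}\,dy,\qquad c_1=\frac{1-q}{1-q^{-2}}=-\frac{q^2}{q+1}.$$ *)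

(* Defs.v *)
From HB Require Import structures.
From mathcomp Require Import all_boot all_order all_algebra.
From mathcomp Require Import complex.
From mathcomp Require Import all_classical all_reals all_analysis.

Set Implicit Arguments.
Unset Strict Implicit.
Unset Printing Implicit Defensive.

Import Order.TTheory GRing.Theory Num.Theory.
Import numFieldNormedType.Exports.

Local Open Scope classical_set_scope.
Local Open Scope ring_scope.

HB.mixin Record isTopologicalField K & TopologicalZmodule K & GRing.Field K := {
  mulf_continuous : continuous (fun x : K * K => x.1 * x.2) ;
  invf_continuous : forall x : K, x != 0 -> {for x, continuous (@GRing.inv K)}
}.

#[short(type="topologicalFieldType")]
HB.structure Definition TopologicalField :=
  {K of TopologicalZmodule K & GRing.Field K & isTopologicalField K}.

(* The Hausdorff property is not listed, as a totally disconnected topological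
   group is Hausdorff. *)
Record nonarch_local_field (K : topologicalFieldType) : Prop := NonarchLocalField {
  lf_nondiscrete : ~ (forall A : set K, open A) ;
  lf_totally_disconnected : totally_disconnected [set: K] ;
  lf_locally_compact : locally_compact [set: K]
}.

Section AbsoluteValue.
Context {R : realType} {K : topologicalFieldType}.
Variable v : K -> R.

Definition integer_ring : set K := [set x | v x <= 1].
Definition prime_ideal : set K := [set x | v x < 1].

(* The elements of O / P, as cosets x + P. *)
Definition residue_classes : set (set K) :=
  [set [set x + y | y in prime_ideal] | x in integer_ring].

(* These conditions determine v and q from the topological field K. *)
Record normalized_abs (q : nat) : Prop := NormalizedAbs {
  abs_ge0 : forall x, 0 <= v x ;
  abs_eq0 : forall x, v x = 0 <-> x = 0 ;
  absM : forall x y, v (x * y) = v x * v y ;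
  abs_ultrametric : forall x y, v (x + y) <= Num.max (v x) (v y) ;
  abs_nbhs : forall x, nbhs x =
    filter_from [set e : R | 0 < e] (fun e => [set y | v (x - y) < e]) ;
  abs_residue_card : (residue_classes #= `I_q)%card ;
  abs_uniformizer : exists2 p : K,
    prime_ideal = [set p * x | x in integer_ring] & v p = q%:R^-1
}.

End AbsoluteValue.

(* [g_sigma_algebraType] asks for a pointed type, which K is not by inheritance;
   the base point plays no role. *)
Definition pointed_field (K : topologicalFieldType) : Type := K.
HB.instance Definition _ (K : topologicalFieldType) :=
  TopologicalField.on (pointed_field K).
HB.instance Definition _ (K : topologicalFieldType) :=
  isPointed.Build (pointed_field K) 0.

Notation borel K := (g_sigma_algebraType (@open (pointed_field K))).

(* On a local field, translation invariance and mu O = 1 determine mu among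
   all Borel measures: finiteness on compact sets and regularity follow. *)
Record normalized_haar (R : realType) (K : topologicalFieldType) (v : K -> R)
    (mu : {measure set (borel K) -> \bar R}) : Prop := NormalizedHaar {
  haar_translation : forall (x : K) (A : set (borel K)), measurable A ->
    mu [set x + y | y in (A : set K)] = mu A ;
  haar_integer_ring : mu (integer_ring v) = 1%E
}.

Section ComplexIntegration.
Context d (T : measurableType d) (R : realType).
Variable mu : {measure set T -> \bar R}.
Implicit Types (D : set T) (f : T -> R[i]).

Definition measurable_funC D f : Prop :=
  measurable_fun D (fun x => complex.Re (f x)) /\
  measurable_fun D (fun x => complex.Im (f x)).

Definition integrableC D f : Prop :=
  mu.-integrable D (fun x => (complex.Re (f x))%:E) /\
  mu.-integrable D (fun x => (complex.Im (f x))%:E).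

Definition integralC D f : R[i] :=
  Complex (\int[mu]_(x in D) complex.Re (f x))
          (\int[mu]_(x in D) complex.Im (f x)).

Definition L1normC f : \bar R :=
  ('N[mu]_1[(fun x => (Normc.normc (f x))%:E)])%E.

End ComplexIntegration.

Section RieszPotential.
Context {R : realType} {K : topologicalFieldType}.
Variables (v : K -> R) (q : nat) (mu : {measure set (borel K) -> \bar R}).
Implicit Types (u phi : K -> R[i]) (x y : K) (eps : R).

Local Notation "r %:C" := (real_complex R r).

Definition Linfty_loc phi : Prop :=
  measurable_funC [set: borel K] phi /\
  forall A : set K, compact A -> exists M : R,
    {ae mu, forall x : borel K, A x -> Normc.normc (phi x) <= M}.

(* phi(t) = O(|t|^s) as |t| tends to infinity *)
Definition bigO_infty phi (s : R) : Prop :=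
  exists C M : R, forall t, M <= v t -> Normc.normc (phi t) <= C * v t `^ s.

Definition d1 : R := (1 - q%:R) / (q%:R * ln q%:R).
Definition c1 : R := (1 - q%:R) / (1 - q%:R ^- 2).

Definition riesz_integrand phi x y : R[i] := (ln (v (x - y)))%:C * phi y.

(* The integrand at the single point y = x has the irrelevant value
   [ln 0 = 0]. *)
Definition log_riesz phi x : R[i] :=
  d1%:C * integralC mu [set: borel K] (riesz_integrand phi x).

Definition outside_ball eps x : set K := [set y | eps <= v (y - x)].

Definition frac_integrand u x y : R[i] := (u y - u x) / (v (y - x) ^+ 2)%:C.

Definition frac_diff1 eps u x : R[i] :=
  c1%:C * integralC mu (outside_ball eps x) (frac_integrand u x).

End RieszPotential.

(* Main.v *)
Require Import Defs.
From HB Require Import structures.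
From mathcomp Require Import all_boot all_order all_algebra.
From mathcomp Require Import complex.
From mathcomp Require Import all_classical all_reals all_analysis.
From mathcomp Require Import measurable_realfun.
From mathcomp Require Import ring lra zify.

(** Substituting the potential into the truncated operator and exchanging the two
    integrals turns [D^1_eps (D^-1 phi)] into the convolution of [phi] with

      k(s) = c1 d1 * integral over |w| >= eps of (ln |s + w| - ln |s|) / |w|^2.

    This kernel is an approximate identity.

    - It vanishes for [|s| >= eps]. On [|w| < |s|] the integrand is zero, because
      the absolute value is ultrametric. On [|w| > |s|] it is
      [(ln |w| - ln |s|) / |w|^2]. On [|w| = |s|] only the [w] with
      [|s + w| < |s|] count, that is a ball around [- s], on which [ln |s + w|]
      is too small. Summed over spheres, both contributions are the same multiple
      of [sum_j j q^-j], with opposite signs ([log_diff_far], [log_diff_integral]).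
    - For [|s| < eps] one has [|s + w| = |w|] on the whole domain, which gives
      [k(s) = c1 d1 / eps * (ln q / (q - 1) - ln (|s| / eps))], a nonnegative
      function ([log_diff_near], [integral_log_outside]).
    - Its integral is [1]: this is what the product [c1 d1] is made for
      ([integral_pre_kernel], [integral_diff_kernel]).

    The exchange of integrals ([frac_log_potential]) needs
    [|phi(z)| (1 + |ln |x - z||)] to be integrable in [z] for each [x]; near [x]
    this follows from local boundedness, at infinity from the decay of [phi]
    ([log_integrable_decay]).

    Since [k] has mass one, the [L^1] distance between [k * phi] and [phi] is at
    most the mean oscillation of [phi], the double integral of
    [|phi(z) - phi(x)| k(x - z)]. The mean oscillation is at most twice the [L^1]
    norm, and it is zero once [eps] is small for a function that is constant on
    the balls of some fixed radius. The sets of finite measure whose indicator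
    has an oscillation tending to zero are handled by a sigma-algebra argument;
    density of the simple functions in [L^1] then covers every integrable
    function ([osc_vanishes_integrable]).

    Every explicit integral is that of a function of [|y - c|]. A sphere of radius
    [q ^ n] has measure [q ^ n (1 - 1 / q)], so such integrals are series over
    spheres, here always of the form [sum_i (a + b i) z ^ i]. The argument is run
    on real functions and applied to the real and imaginary parts of [phi]. *)

Set Implicit Arguments.
Unset Strict Implicit.
Unset Printing Implicit Defensive.

Import Order.TTheory GRing.Theory Num.Theory.
Import numFieldNormedType.Exports.
Import HBSimple.

Local Open Scope classical_set_scope.
Local Open Scope ring_scope.

(** * The absolute value and its balls *)

Section AbsTheory.
Context {R : realType} {K : topologicalFieldType}.
Variables (v : K -> R) (q : nat).
Hypothesis Hv : normalized_abs v q.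
Implicit Types (x y c : K) (n : int).

Local Notation Q := (q%:R : R).

(** Balls are typed as sets of the Borel space, and only radii in the value group
    are used; then open and closed balls coincide up to a shift of the exponent. *)
Definition vball c n : set (borel K) := [set y : K | v (y - c) <= Q ^ n].
Definition vsphere c n : set (borel K) := [set y : K | v (y - c) = Q ^ n].

Lemma v_0 : v 0 = 0. Proof. exact/(abs_eq0 Hv). Qed.

Lemma v_gt0 x : (0 < v x) = (x != 0).
Proof.
rewrite lt_neqAle (abs_ge0 Hv) andbT eq_sym; congr (~~ _).
by apply/eqP/eqP => /(abs_eq0 Hv).
Qed.

Lemma v_1 : v 1 = 1.
Proof.
have v1 : v 1 != 0 by rewrite gt_eqF// v_gt0 oner_neq0.
by apply: (mulIf v1); rewrite -(absM Hv) !mul1r.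
Qed.

Lemma v_N x : v (- x) = v x.
Proof.
have vN1 : v (-1) = 1.
  have /eqP : v (-1) ^+ 2 = 1 by rewrite expr2 -(absM Hv) mulrNN mulr1 v_1.
  rewrite sqrf_eq1 => /orP[/eqP//|/eqP e].
  by have := abs_ge0 Hv (-1); rewrite e lerNr oppr0 ler10.
by rewrite -mulN1r (absM Hv) vN1 mul1r.
Qed.

Lemma v_sub x y : v (x - y) = v (y - x).
Proof. by rewrite -v_N opprB. Qed.

Lemma v_le_add x y (r : R) : v x <= r -> v y <= r -> v (x + y) <= r.
Proof.
by move=> xr yr; rewrite (le_trans (abs_ultrametric Hv _ _))// ge_max xr yr.
Qed.

Lemma v_lt_add x y (r : R) : v x < r -> v y < r -> v (x + y) < r.
Proof.
by move=> xr yr; rewrite (le_lt_trans (abs_ultrametric Hv _ _))// gt_max xr yr.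
Qed.

(** The isosceles triangle principle. *)
Lemma v_dominant x y : v x < v y -> v (x + y) = v y.
Proof.
move=> xy; apply/eqP; rewrite eq_le v_le_add ?(ltW xy)//= leNgt.
apply/negP => xyy; suff : v y < v y by rewrite ltxx.
by rewrite -{1}[y](addKr x) v_lt_add// v_N.
Qed.

Lemma v_V x : v x^-1 = (v x)^-1.
Proof.
have [->|x0] := eqVneq x 0; first by rewrite invr0 v_0 invr0.
have vx0 : v x != 0 by rewrite gt_eqF// v_gt0.
by apply: (mulIf vx0); rewrite -(absM Hv) !mulVf// v_1.
Qed.

Lemma v_exprz x n : v (x ^ n) = v x ^ n.
Proof.
have vX k : v (x ^+ k) = v x ^+ k.
  by elim: k => [|k IH]; rewrite ?expr0 ?v_1// !exprS (absM Hv) IH.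
by case: n => n; rewrite ?NegzE -?exprnP -?exprnN ?v_V vX.
Qed.

(** One representative is chosen in each residue class; two of them are congruent
    only if they have the same index. *)
Lemma residue_reps : exists r : nat -> K,
  [/\ forall i, (i < q)%N -> v (r i) <= 1,
      forall x, v x <= 1 -> exists2 i, (i < q)%N & v (x - r i) < 1
    & forall i j, (i < q)%N -> (j < q)%N -> v (r i - r j) < 1 -> i = j].
Proof.
have : (`I_q #= residue_classes v)%card.
  by rewrite card_eq_sym; exact: abs_residue_card Hv.
move=> /card_set_bijP[f [fun_f inj_f surj_f]].
have self x : prime_ideal v 0 by rewrite /prime_ideal/= v_0.
pose P x := [set x + y | y in prime_ideal v].
have PE x y : P x y <-> v (y - x) < 1.
  split=> [[z vz <-]|yx]; first by rewrite addrAC subrr add0r.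
  by exists (y - x) => //; rewrite addrC subrK.
have choice_r i : exists c, (i < q)%N -> v c <= 1 /\ f i = P c.
  have [iq|] := boolP (i < q)%N; last by exists 0.
  by have [c c1 fi] := fun_f _ iq; exists c.
have [r rP] := choice choice_r; exists r; split.
- by move=> i /rP[].
- move=> x x1; have /surj_f[i /= iq fi] : residue_classes v (P x) by exists x.
  exists i => //; have [_ fir] := rP _ iq.
  by apply/PE; rewrite -fir fi; apply/PE; rewrite subrr v_0.
- move=> i j iq jq rij; have [_ fi] := rP _ iq; have [_ fj] := rP _ jq.
  apply: inj_f; rewrite ?inE//= fi fj; apply/seteqP; split => y /PE yi; apply/PE.
    by rewrite -(subrKA (r i)) v_lt_add.
  by rewrite -(subrKA (r j)) v_lt_add// v_sub.
Qed.

(** The classes of [0] and [1] are distinct. *)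
Lemma q_gt1 : (1 < q)%N.
Proof.
have [r [_ cover sep]] := residue_reps.
have [i iq i0] := cover 0 ltac:(by rewrite v_0).
have [j jq j1] := cover 1 ltac:(by rewrite v_1).
have ij : i <> j.
  move=> ij; have : v 1 < 1; last by rewrite v_1 ltxx.
  by rewrite -[X in v X](subrK (r j)) v_lt_add// -ij -[r i]subr0 v_sub.
by move: iq jq ij; case: q => [|[|]]//; case: i {i0} => //; case: j {j1}.
Qed.

Lemma Q_gt1 : 1 < Q. Proof. by rewrite ltr1n q_gt1. Qed.

Lemma Q_gt0 : 0 < Q. Proof. exact: lt_trans Q_gt1. Qed.

Lemma Qz_gt0 n : 0 < Q ^ n. Proof. by rewrite exprz_gt0// Q_gt0. Qed.

Lemma lnQ_gt0 : 0 < ln Q. Proof. by rewrite ln_gt0// Q_gt1. Qed.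

Lemma ln_Qz n : ln (Q ^ n) = n%:~R * ln Q.
Proof.
case: n => n; first by rewrite -exprnP lnXn ?Q_gt0// -[LHS]mulr_natl.
rewrite NegzE -exprnN lnV ?posrE ?exprn_gt0 ?Q_gt0// lnXn ?Q_gt0//.
by rewrite mulrNz mulNr; congr (- _); rewrite -[LHS]mulr_natl.
Qed.

Lemma QzD n m : Q ^ (n + m) = Q ^ n * Q ^ m.
Proof. by rewrite expfzDr// gt_eqF// Q_gt0. Qed.

Lemma ler_Qz n m : (Q ^ n <= Q ^ m) = (n <= m).
Proof. by rewrite ler_eXz2l// Q_gt1. Qed.

Lemma ltr_Qz n m : (Q ^ n < Q ^ m) = (n < m).
Proof. by rewrite ltr_eXz2l// Q_gt1. Qed.

Lemma v_surj n : exists t : K, v t = Q ^ n.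
Proof.
have [p _ vp] := abs_uniformizer Hv.
by exists (p ^ (- n)); rewrite v_exprz vp exprz_inv opprK.
Qed.

(** The uniformizer generates the maximal ideal, so there is no absolute value
    strictly between two consecutive powers of [q]. *)
Lemma v_lt_Qz x n : (v x < Q ^ n) = (v x <= Q ^ (n - 1)).
Proof.
apply/idP/idP => [xn|/le_lt_trans]; last by apply; rewrite ltr_Qz; lia.
have [t vt] := v_surj (- n).
have [p PE vp] := abs_uniformizer Hv.
have : prime_ideal v (t * x).
  rewrite /prime_ideal/= (absM Hv) vt -invr_expz mulrC ltr_pdivrMr ?Qz_gt0//.
  by rewrite mul1r.
rewrite PE => -[y y1 /(congr1 v)]; rewrite !(absM Hv) vp vt => e.
have -> : v x = Q ^ n * (Q ^ (- n) * v x).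
  by rewrite mulrA -QzD subrr expr0z mul1r.
by rewrite -e QzD ler_pM2l ?Qz_gt0// exprN1 ler_piMr// invr_ge0 ltW// Q_gt0.
Qed.

Lemma v_Qz x : x != 0 -> exists n, v x = Q ^ n.
Proof.
rewrite -v_gt0 => x0.
pose n := Num.floor (ln (v x) / ln Q); exists n.
have lnx : n%:~R <= ln (v x) / ln Q < (n + 1)%:~R by rewrite floor_itv.
move: lnx; rewrite ler_pdivlMr ?lnQ_gt0// ltr_pdivrMr ?lnQ_gt0// -!ln_Qz.
rewrite ler_ln ?posrE ?Qz_gt0// ltr_ln ?posrE ?Qz_gt0// v_lt_Qz addrK.
by move=> ?; apply/eqP; rewrite eq_le andbC.
Qed.

(** The [q] residue classes, translated and scaled. This is where the
    cardinality of the residue field enters the measure of balls. *)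
Lemma vball_split c n : exists r : nat -> K,
  vball c n = \big[setU/set0]_(i < q) vball (r i) (n - 1) /\
  trivIset `I_q (fun i => vball (r i) (n - 1)).
Proof.
have [r [r1 cover sep]] := residue_reps; have [t vt] := v_surj n.
have t0 : t != 0 by rewrite -v_gt0 vt Qz_gt0.
have scale y z : v (y - (c + t * z)) = Q ^ n * v ((y - c) / t - z).
  by rewrite -vt -(absM Hv) mulrBr mulrCA divff// mulr1 opprD addrA.
have inE' z y : vball (c + t * z) (n - 1) y = (v ((y - c) / t - z) < 1) :> Prop.
  rewrite /vball/= -v_lt_Qz scale -{2}[Q ^ n]mulr1 ltr_pM2l ?Qz_gt0//.
exists (fun i => c + t * r i); split.
  rewrite -(bigcup_mkord q (fun i => vball (c + t * r i) (n - 1))); apply/seteqP.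
  split => [y yc|y [i /= iq]].
    have [|i iq yi] := cover ((y - c) / t).
      by rewrite (absM Hv) v_V vt ler_pdivrMr ?Qz_gt0// mul1r.
    by exists i; rewrite ?inE'.
  rewrite inE' => yi; rewrite /vball/=.
  have -> : y - c = t * ((y - c) / t - r i + r i).
    by rewrite subrK mulrC divfK.
  by rewrite (absM Hv) vt ler_piMr ?(ltW (Qz_gt0 _))// v_le_add ?r1// ltW.
apply/trivIsetP => i j iq jq ij; apply/seteqP; split => // y [].
rewrite !inE' => yi yj; apply: (negP ij); apply/eqP/sep => //.
by rewrite -(subrKA ((y - c) / t)) v_lt_add// v_sub.
Qed.

Lemma vball_eq c x n : vball c n x -> vball c n = vball x n.
Proof.
rewrite /vball/= => xc; apply/seteqP; split => y /= yc.
  by rewrite -(subrKA c) v_le_add// v_sub.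
by rewrite -(subrKA x) v_le_add.
Qed.

Lemma vball_center c n : vball c n c.
Proof. by rewrite /vball/= subrr v_0 ltW// Qz_gt0. Qed.

Lemma vball_mono c n m : n <= m -> vball c n `<=` vball c m.
Proof. by move=> nm y /= /le_trans; apply; rewrite ler_Qz. Qed.

Lemma nbhs_vball c n : nbhs c (vball c n : set K).
Proof.
rewrite (abs_nbhs Hv); exists (Q ^ n); first exact: Qz_gt0.
by move=> y /=; rewrite v_sub => /ltW.
Qed.

Lemma open_vball c n : open (vball c n : set K).
Proof.
rewrite openE => y /vball_eq ->; exact: nbhs_vball.
Qed.

Lemma Qz_small (e : R) : 0 < e -> exists k : nat, Q ^ (- k%:Z) < e.
Proof.
move=> e0.
have [k ke] : exists k : nat, e^-1 < k%:R.
  by exists (Num.truncn e^-1).+1; rewrite truncnS_gt.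
exists k; rewrite -invr_expz -exprnP invf_plt ?posrE ?exprn_gt0 ?Q_gt0//.
apply: (lt_le_trans ke); rewrite -natrX ler_nat ltnW//.
exact: ltn_expl q_gt1.
Qed.

Lemma nbhs_vballP c (A : set K) :
  nbhs c A <-> exists k : nat, vball c (- k%:Z) `<=` A.
Proof.
split=> [|[k kA]]; last by apply: filterS (nbhs_vball c (- k%:Z)).
rewrite (abs_nbhs Hv) => -[e /= e0 eA]; have [k ke] := Qz_small e0; exists k.
by move=> y yk; apply: eA => /=; rewrite v_sub (le_lt_trans yk).
Qed.

Lemma vball_exhaust x : exists k : nat, forall m, k%:Z <= m -> vball 0 m x.
Proof.
have [->|x0] := eqVneq x 0; first by exists 0 => m _; exact: vball_center.
have [n vx] := v_Qz x0; exists `|n|%N => m nm.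
by rewrite /vball/= subr0 vx ler_Qz; lia.
Qed.

Lemma measurable_vball c n : measurable (vball c n).
Proof. by apply: sub_sigma_algebra; exact: open_vball. Qed.

Lemma vsphereE c n : vsphere c n = vball c n `\` vball c (n - 1).
Proof.
apply/seteqP; split => y; rewrite /vsphere/vball/= -v_lt_Qz.
  by move=> ->; rewrite ltxx.
by move=> [yn /negP]; rewrite -leNgt => ny; apply/eqP; rewrite eq_le yn.
Qed.

Lemma measurable_vsphere c n : measurable (vsphere c n).
Proof. by rewrite vsphereE; apply: measurableD; exact: measurable_vball. Qed.

End AbsTheory.

(** * Haar measure of balls and spheres *)

Section HaarMeasure.
Context {R : realType} {K : topologicalFieldType}.
Variables (v : K -> R) (q : nat).
Hypothesis Hv : normalized_abs v q.
Implicit Types (x y c : K) (n : int).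
Local Notation Q := (q%:R : R).
Local Notation vball := (vball v q).
Local Notation vsphere := (vsphere v q).

(** Without a countable base, the product of two Borel algebras may fail to contain
    all open sets. The countability used here comes from splitting the ball of
    radius [q ^ (n + k)] [k] times. *)
Lemma vball_cover n : exists d : nat -> nat -> K,
  forall y, exists i j, vball (d i j) n y.
Proof.
have cover_k (k : nat) : exists s : seq K,
    forall y, vball 0 (n + k%:Z) y -> exists2 d, d \in s & vball d n y.
  elim: k => [|k [s sP]].
    by exists [:: 0]; rewrite addr0 => y y0; exists 0; rewrite ?mem_seq1.
  have [r [rE _]] := vball_split Hv 0 (n + k.+1%:Z).
  have shift i : exists u : seq K, forall y, vball (r i) (n + k%:Z) y ->
      exists2 d, d \in u & vball d n y.
    exists [seq d + r i | d <- s] => y.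
    rewrite /vball/= => yi; have [|d ds dy] := sP (y - r i).
      by rewrite /vball/= subr0.
    exists (d + r i); first exact: map_f.
    by rewrite /vball/= opprD addrA addrAC.
  have [t vt] := choice shift.
  exists (flatten [seq t i | i <- iota 0 q]) => y.
  rewrite rE -(bigcup_mkord q (fun i => vball (r i) _)) => -[i /= iq].
  rewrite (_ : _ - 1 = n + k%:Z); last by lia.
  move=> /vt[d dt dy]; exists d => //; apply/flatten_mapP; exists i => //.
  by rewrite mem_iota.
have [s sP] := choice cover_k.
exists (fun k j => nth 0 (s k) j) => y.
have [m my] := vball_exhaust Hv y.
have [|d /(nthP 0)[j _ <-]] := sP (`|m%:Z - n|%N) y; first by apply: my; lia.
by exists `|m%:Z - n|%N, j.
Qed.

(** Subtraction is measurable for the product of the Borel algebras, although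
    that product is a priori coarser than the Borel algebra of [K * K]. *)
Lemma measurable_v_sub :
  measurable_fun setT (fun p : borel K * borel K => v ((p.1 : K) - (p.2 : K))).
Proof.
apply: (measurability _ (RGenInftyO.measurableE R)) => // _ [_ [r ->] <-].
rewrite setTI.
have [r0|r0] := leP r 0.
  rewrite (_ : _ @^-1` _ = set0)//; apply/seteqP; split => // -[x y].
  by rewrite /= in_itv/= ltNge (le_trans r0 (abs_ge0 Hv _)).
have [n nr] := Qz_small Hv r0.
have [d dP] := vball_cover (- n%:Z).
pose B i j k l := if v (d i j - d k l) < r
  then vball (d i j) (- n%:Z) `*` vball (d k l) (- n%:Z) else set0.
rewrite (_ : _ @^-1` _ = \bigcup_i \bigcup_j \bigcup_k \bigcup_l B i j k l).
  do 4 (apply: bigcup_measurable => ? _); rewrite /B; case: ifP => // _.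
  by apply: measurableX; exact: measurable_vball.
have tri x y z : v (x - y) < r -> v (y - z) < r -> v (x - z) < r.
  by move=> xy yz; rewrite -(subrKA y) (v_lt_add Hv).
have near c x : vball c (- n%:Z) x -> v (x - c) < r /\ v (c - x) < r.
  by rewrite /vball/= => /le_lt_trans/(_ nr) xc; rewrite (v_sub Hv c).
apply/seteqP; split => [[x y]|[x y] [i _ [j _ [k _ [l _]]]]].
  rewrite /= in_itv/= => xy.
  have [i [j xi]] := dP x; have [k [l yk]] := dP y.
  exists i => //; exists j => //; exists k => //; exists l => //; rewrite /B.
  have [? ?] := near _ _ xi; have [? ?] := near _ _ yk.
  by rewrite ifT//; apply: (tri _ x) => //; apply: (tri _ y).
rewrite /B; case: ifP => //= dr [/near[? ?] /near[? ?]]; rewrite in_itv/=.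
by apply: (tri _ (d i j)) => //; apply: (tri _ (d k l)).
Qed.

Lemma measurable_v c : measurable_fun setT (fun y : borel K => v ((y : K) - c)).
Proof.
exact: (measurableT_comp measurable_v_sub
  (@pair2_measurable _ _ (borel K) (borel K) (c : borel K))).
Qed.

Variable mu : {measure set (borel K) -> \bar R}.
Hypothesis Hmu : normalized_haar v mu.

Lemma haar_vball_center c n : mu (vball c n) = mu (vball 0 n).
Proof.
rewrite -(haar_translation Hmu c (measurable_vball Hv 0 n)); congr (mu _).
rewrite /vball; apply/seteqP; split => [y /= yc|_ [y /= y0 <-]].
  by exists (y - c); rewrite ?subr0// addrC subrK.
by move: y0; rewrite subr0 addrAC subrr add0r.
Qed.

(** Splitting a ball into [q] translates of the next smaller one multiplies
    the measure by [q ^ -1] at each step, starting from the ring of integers. *)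
Lemma haar_vball c n : mu (vball c n) = (Q ^ n)%:E.
Proof.
have step m : mu (vball 0 m) = (Q%:E * mu (vball 0 (m - 1))%R)%E.
  have [r [-> tI]] := vball_split Hv 0 m.
  rewrite (@measure_bigsetU_ord _ _ _ mu q xpredT (fun i : 'I_q => vball (r i) (m - 1)%R)).
  - transitivity (\sum_(i < q) mu (vball 0 (m - 1))%R)%E.
      by apply: eq_bigr => i _; exact: haar_vball_center.
    by rewrite sumr_const card_ord mule_natl.
  - by move=> i; exact: measurable_vball.
  - move/trivIsetP: tI => tI; apply/trivIsetP => i j _ _ ij.
    by apply: tI => /=; rewrite ?ltn_ord.
rewrite haar_vball_center; elim/int_rec: n => [|n IH|n IH].
- rewrite expr0z -(haar_integer_ring Hmu); congr (mu _).
  by apply/seteqP; split => y; rewrite /vball/integer_ring/= subr0 expr0z.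
- rewrite step (_ : _ - 1 = n%:Z); last by lia.
  by rewrite IH -EFinM -exprSz.
- have Q0 := Q_gt0 Hv.
  have := step (- n%:Z); rewrite IH (_ : - n%:Z - 1 = - n.+1%:Z); last by lia.
  have fin : mu (vball 0 (- n.+1%:Z)) \is a fin_num.
    rewrite ge0_fin_numE//; apply: (@le_lt_trans _ _ (mu (vball 0 (- n%:Z)))).
      apply: le_measure; rewrite ?inE; try exact: measurable_vball.
      by apply: vball_mono => //; lia.
    by rewrite IH ltry.
  rewrite -(fineK fin).
  rewrite -EFinM => -[e]; congr EFin.
  apply: (mulfI (lt0r_neq0 Q0)); rewrite -e (_ : - n%:Z = 1 + - n.+1%:Z); last by lia.
  by rewrite (QzD Hv) expr1z.
Qed.

Lemma haar_vsphere c n : mu (vsphere c n) = (Q ^ n * (1 - Q^-1))%:E.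
Proof.
have -> : mu (vsphere c n) = (mu (vball c n) - mu (vball c (n - 1)%R))%E.
  rewrite (vsphereE Hv).
  rewrite (@measureD _ _ _ mu _ _ (measurable_vball Hv c n) (measurable_vball Hv c (n - 1))).
    by rewrite setIidr//; apply: vball_mono => //; lia.
  by have := haar_vball c n; move=> /= ->; rewrite ltry.
rewrite !haar_vball (_ : Q ^ n * (1 - Q^-1) = Q ^ n - Q ^ (n - 1))//.
by rewrite (QzD Hv) exprN1 mulrBr mulr1.
Qed.

Lemma set1_vballE c : [set c : borel K] = \bigcap_k vball c (- k%:Z).
Proof.
apply/seteqP; split => [_ -> k _|y yc /=]; first exact: vball_center.
apply/eqP; rewrite -(subr_eq0 (y : K)) -(negbK (_ == 0)) -(v_gt0 Hv).
apply/negP => /(Qz_small Hv)[k]; rewrite ltNge => /negP; apply; exact: yc.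
Qed.

Lemma measurable_set1K c : measurable [set c : borel K].
Proof.
by rewrite set1_vballE; apply: bigcapT_measurable => k; exact: measurable_vball.
Qed.

Lemma haar_set1 c : mu [set c : borel K] = 0%E.
Proof.
apply/eqP; rewrite eq_le measure_ge0 andbT; apply/lee_addgt0Pr => e e0.
have [k /ltW ke] := Qz_small Hv e0; rewrite add0e.
apply: (@le_trans _ _ (Q ^ (- k%:Z))%:E); last by rewrite lee_fin.
rewrite -(haar_vball c); apply: le_measure; rewrite ?inE.
- exact: measurable_set1K.
- exact: measurable_vball.
- by move=> _ ->; exact: vball_center.
Qed.

Lemma haar_sigma_finite : sigma_finite [set: borel K] mu.
Proof.
exists (fun k : nat => vball 0 k%:Z).
  apply/seteqP; split => // y _; have [k ky] := vball_exhaust Hv y.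
  by exists k => //; exact: ky.
by move=> k; split; [exact: measurable_vball | rewrite haar_vball ltry].
Qed.

End HaarMeasure.

(** * Integrals of radial functions *)

Section ArithmeticGeometricSeries.
Context {R : realType}.

Lemma cvg_arithmetic_geometric (a b z : R) : 0 <= a -> 0 <= b -> 0 <= z < 1 ->
  series (fun i => (a + b * i%:R) * z ^+ i) @ \oo -->
    a / (1 - z) + b * z / (1 - z) ^+ 2.
Proof.
move=> a0 b0 /andP[z0 z1]; set L := (X in _ --> X).
pose u i := (a + b * i%:R) * z ^+ i.
have z1' : 0 < 1 - z by rewrite subr_gt0.
have u0 i : 0 <= u i by rewrite mulr_ge0 ?exprn_ge0// addr_ge0// mulr_ge0.
(* The remainder of the series has a closed form, found by undetermined
   coefficients; it gives the sum once the general term is known to vanish. *)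
have uE n : series u n = L - (u n / (1 - z) + b * z / (1 - z) ^+ 2 * z ^+ n).
  elim: n => [|n IH].
    rewrite /series/= big_geq// /u /L mulr0 addr0 expr0; field.
    exact: lt0r_neq0.
  rewrite /series/= big_nat_recr//= -[X in X + _]/(series u n) IH /u (exprS z) -natr1.
  by field; exact: lt0r_neq0.
have u_cvg0 : u @ \oo --> 0.
  apply: cvg_series_cvg_0; apply: nondecreasing_is_cvgn.
    by apply/nondecreasing_seqP => n; rewrite /series/= big_nat_recr//= lerDl.
  exists L => _ [n _ <-]; rewrite uE gerBl addr_ge0//.
    by rewrite divr_ge0// ltW.
  by rewrite !mulr_ge0 ?exprn_ge0// invr_ge0 exprn_ge0// ltW.
rewrite (_ : series _ = fun n => L - (u n / (1 - z) + b * z / (1 - z) ^+ 2 * z ^+ n));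
  last exact/funext.
rewrite -[X in _ --> X]subr0; apply: cvgB; first exact: cvg_cst.
rewrite (_ : 0 = 0 * (1 - z)^-1 + b * z / (1 - z) ^+ 2 * 0); last first.
  by rewrite mul0r mulr0 addr0.
apply: cvgD; apply: cvgM => //; [exact: cvg_cst|exact: cvg_cst|].
by apply: cvg_expr; rewrite ger0_norm.
Qed.

Lemma nneseries_arithmetic_geometric (a b z : R) :
  0 <= a -> 0 <= b -> 0 <= z < 1 ->
  (\sum_(i <oo) ((a + b * i%:R) * z ^+ i)%:E =
   (a / (1 - z) + b * z / (1 - z) ^+ 2)%:E)%E.
Proof.
move=> a0 b0 z01; apply/cvg_lim => //; apply: cvg_EFin.
  by apply: nearW => n; rewrite sumEFin.
rewrite [X in X @ _ --> _](_ : _ = series (fun i => (a + b * i%:R) * z ^+ i)).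
  exact: cvg_arithmetic_geometric.
by apply/funext => n /=; rewrite sumEFin.
Qed.

End ArithmeticGeometricSeries.

Section RadialIntegrals.
Context {R : realType} {K : topologicalFieldType}.
Variables (v : K -> R) (q : nat).
Hypothesis Hv : normalized_abs v q.
Variable mu : {measure set (borel K) -> \bar R}.
Hypothesis Hmu : normalized_haar v mu.
Implicit Types (x y c : K) (n : int) (h : R -> R).
Local Notation Q := (q%:R : R).
Local Notation vball := (vball v q).
Local Notation vsphere := (vsphere v q).
Local Notation outside c n := (outside_ball v (Q ^ n) c : set (borel K)).

Lemma outsideE c n : outside c n = ~` vball c (n - 1).
Proof.
apply/seteqP; split => y; rewrite /outside_ball/vball/= -(v_lt_Qz Hv) => ny.
  by apply/negP; rewrite -leNgt.
by rewrite leNgt; apply/negP.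
Qed.

Lemma measurable_outside c n : measurable (outside c n).
Proof. by rewrite outsideE; apply: measurableC; exact: measurable_vball. Qed.

Lemma measurable_radial c h : measurable_fun setT h ->
  measurable_fun setT (fun y : borel K => h (v ((y : K) - c))).
Proof. by move=> mh; apply: measurableT_comp => //; exact: measurable_v Hv c. Qed.

(** The radii are given by an injection [s] so as to serve both for balls, whose
    spheres shrink, and for complements of balls, whose spheres grow. *)
Lemma integral_vspheres c (s : nat -> int) h (a b z : R) :
  injective s -> measurable_fun setT h ->
  0 <= a -> 0 <= b -> 0 <= z < 1 ->
  (forall i, 0 <= h (Q ^ s i)) ->
  (forall i, h (Q ^ s i) * (Q ^ s i * (1 - Q^-1)) = (a + b * i%:R) * z ^+ i) ->
  (\int[mu]_(y in \bigcup_i vsphere c (s i)) (h (v ((y : K) - c)))%:E =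
   (a / (1 - z) + b * z / (1 - z) ^+ 2)%:E)%E.
Proof.
move=> s_inj mh a0 b0 z01 h0 hE.
rewrite ge0_integral_bigcup.
- rewrite -nneseries_arithmetic_geometric//; apply: eq_eseriesr => i _.
  rewrite (eq_integral (cst (h (Q ^ s i))%:E)); last first.
    by move=> y /set_mem; rewrite /vsphere/= => ->.
  rewrite integral_cst; last exact: measurable_vsphere.
  by have := haar_vsphere Hv Hmu c (s i) => /= ->; rewrite -EFinM hE.
- by move=> i; exact: measurable_vsphere.
- by apply/measurable_EFinP; apply: measurable_funTS; exact: measurable_radial.
- by move=> y [i _ /= yi]; rewrite lee_fin yi.
- apply/trivIsetP => i j _ _; apply: contra_neqP => /eqP/set0P[y [/= yi yj]].
  apply: s_inj; apply: le_anti; rewrite -!(ler_Qz Hv).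
  by move: yi yj; rewrite /vsphere/= => <- ->; rewrite lexx.
Qed.

Lemma integral_outside c n h (a b z : R) : measurable_fun setT h ->
  0 <= a -> 0 <= b -> 0 <= z < 1 ->
  (forall i : nat, 0 <= h (Q ^ (n + i%:Z))) ->
  (forall i : nat, h (Q ^ (n + i%:Z)) * (Q ^ (n + i%:Z) * (1 - Q^-1)) =
    (a + b * i%:R) * z ^+ i) ->
  (\int[mu]_(y in outside c n) (h (v ((y : K) - c)))%:E =
   (a / (1 - z) + b * z / (1 - z) ^+ 2)%:E)%E.
Proof.
move=> mh a0 b0 z01 h0 hE; pose s i := n + i%:Z.
rewrite -(@integral_vspheres c s h)//; last by move=> i j; rewrite /s; lia.
congr (integral _ _ _); apply/seteqP; split => y; rewrite /outside_ball/=.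
  move=> ny; have [|m ym] := @v_Qz _ _ _ _ Hv (y - c).
    by rewrite -(v_gt0 Hv) (lt_le_trans (Qz_gt0 Hv n)).
  move: ny; rewrite ym (ler_Qz Hv) => nm.
  by exists `|m - n|%N => //; rewrite /vsphere/= ym /s; congr (_ ^ _); lia.
by move=> [i _]; rewrite /vsphere/= => ->; rewrite (ler_Qz Hv) /s; lia.
Qed.

(** The center is a null set, so the value of [h] at [0] only has to be
    nonnegative. *)
Lemma integral_vball c n h (a b z : R) : measurable_fun setT h ->
  0 <= a -> 0 <= b -> 0 <= z < 1 ->
  (forall r, 0 <= r <= Q ^ n -> 0 <= h r) ->
  (forall i : nat, h (Q ^ (n - i%:Z)) * (Q ^ (n - i%:Z) * (1 - Q^-1)) =
    (a + b * i%:R) * z ^+ i) ->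
  (\int[mu]_(y in vball c n) (h (v ((y : K) - c)))%:E =
   (a / (1 - z) + b * z / (1 - z) ^+ 2)%:E)%E.
Proof.
move=> mh a0 b0 z01 h0 hE; pose s i := n - i%:Z.
rewrite (@ge0_negligible_integral _ _ _ _ _ [set c : borel K]); last first.
- exact (haar_set1 Hv Hmu c).
- by move=> y yc; rewrite lee_fin h0// (abs_ge0 Hv).
- by apply/measurable_EFinP; apply: measurable_funTS; exact: measurable_radial.
- exact: measurable_vball.
- exact: measurable_set1K Hv c.
rewrite -(@integral_vspheres c s h)//; first last.
- by move=> i; apply: h0; rewrite ltW ?(Qz_gt0 Hv)//= (ler_Qz Hv) /s; lia.
- by move=> i j; rewrite /s; lia.
congr (integral _ _ _); apply/seteqP; split => y; rewrite /vball/=.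
  move=> [yn yc]; have [|m ym] := @v_Qz _ _ _ _ Hv (y - c).
    by rewrite subr_eq0; apply/eqP.
  move: yn; rewrite ym (ler_Qz Hv) => mn.
  by exists `|n - m|%N => //; rewrite /vsphere/= ym /s; congr (_ ^ _); lia.
move=> [i _]; rewrite /vsphere/= => yi; split.
  by rewrite yi (ler_Qz Hv) /s; lia.
by move=> yc; have := Qz_gt0 Hv (s i); rewrite -yi yc subrr (v_0 Hv) ltxx.
Qed.

End RadialIntegrals.

(** * The kernel of the truncated operator *)

Lemma measurable_invr (R : realType) : measurable_fun setT (@GRing.inv R).
Proof.
rewrite (_ : setT = [set 0] `|` ~` [set 0]); last by rewrite setUv.
apply/measurable_funU => //; first exact: measurableC.
split; first exact: measurable_fun_set1.
apply: open_continuous_measurable_fun.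
  by apply: closed_openC; exact: closed_eq.
by move=> x /set_mem/= /eqP x0; exact: inv_continuous.
Qed.

Section Kernel.
Context {R : realType} {K : topologicalFieldType}.
Variables (v : K -> R) (q : nat).
Hypothesis Hv : normalized_abs v q.
Variable mu : {measure set (borel K) -> \bar R}.
Hypothesis Hmu : normalized_haar v mu.
Implicit Types (x y z w c : K) (m n : int) (r : R).
Local Notation Q := (q%:R : R).
Local Notation vball := (vball v q).
Local Notation outside c n := (outside_ball v (Q ^ n) c : set (borel K)).

Lemma integral_indicM (A : set (borel K)) (f : borel K -> R) :
  (\int[mu]_w (\1_A w * f w)%:E = \int[mu]_(w in A) (f w)%:E)%E.
Proof.
rewrite [RHS]integral_mkcond; apply: eq_integral => w _.
by rewrite patchE indicE; case: (w \in A); rewrite ?mul1r ?mul0r.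
Qed.

Let Q0 : 0 < Q := Q_gt0 Hv.
Let Qn0 n : 0 < Q ^ n := Qz_gt0 Hv n.
Let l0 : 0 < ln Q := lnQ_gt0 Hv.
Let Q1 : 0 < Q - 1. Proof. by rewrite subr_gt0 (Q_gt1 Hv). Qed.
Let QV01 : 0 <= Q^-1 < 1.
Proof. by rewrite invr_ge0 (ltW Q0) invf_lt1// (Q_gt1 Hv). Qed.
Let w0 : 0 <= 1 - Q^-1.
Proof. by rewrite subr_ge0 ltW//; case/andP: QV01. Qed.

Let Q_neq0 : Q != 0 := lt0r_neq0 Q0.
Let Q1_neq0 : Q - 1 != 0 := lt0r_neq0 Q1.
Let Qn_neq0 n : Q ^ n != 0 := lt0r_neq0 (Qn0 n).

Lemma ln_QzM n r : 0 < r -> ln (Q ^ (- n) * r) = ln r - n%:~R * ln Q.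
Proof. by move=> r0; rewrite lnM ?posrE// (ln_Qz Hv) mulrNz mulNr addrC. Qed.

Lemma measurable_ln_shift r : measurable_fun setT (fun s : R => ln (r * s)).
Proof.
by apply: measurableT_comp; [exact: measurable_ln|exact: mulrl_measurable].
Qed.

(** The sum of a geometric and an arithmetico-geometric series; the value is kept
    for all [m <= n] because both ranges of the kernel use it. *)
Lemma integral_log_outside c n m : m <= n ->
  (\int[mu]_(y in outside c n)
     ((ln (v ((y : K) - c)) - ln (Q ^ m)) / v ((y : K) - c) ^+ 2)%:E =
   (Q ^ (- n) * ln Q * ((n - m)%:~R + (Q - 1)^-1))%:E)%E.
Proof.
move=> mn; pose h r := (ln r - ln (Q ^ m)) / r ^+ 2.
have nm0 : 0 <= (n - m)%:~R :> R by rewrite ler0z subr_ge0.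
have hE i : h (Q ^ (n + i%:Z)) =
    ((n - m)%:~R + i%:R) * ln Q / (Q ^ (n + i%:Z)) ^+ 2.
  by rewrite /h !(ln_Qz Hv) -mulrBl -intrB addrAC [in LHS]intrD.
have b0 : 0 <= ln Q * (1 - Q^-1) * Q ^ (- n).
  by rewrite !mulr_ge0// ltW// Qn0.
rewrite (@integral_outside _ _ _ _ Hv mu Hmu c n h
  ((n - m)%:~R * (ln Q * (1 - Q^-1) * Q ^ (- n)))
  (ln Q * (1 - Q^-1) * Q ^ (- n)) Q^-1) //.
- congr EFin; field; rewrite Q_neq0/= Q1_neq0//.
- apply: measurable_funM; first by apply: measurable_funB => //; exact: measurable_ln.
  apply: measurableT_comp; first exact: measurable_invr.
  exact: measurable_funX.
- by rewrite mulr_ge0.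
- by move=> i; rewrite hE divr_ge0// ?exprn_ge0// ?mulr_ge0// ?addr_ge0// ltW.
- move=> i; rewrite hE (QzD Hv) -invr_expz -exprnP exprVn.
  by field; rewrite ?expf_neq0// Q_neq0 Qn_neq0.
Qed.

(** The radius is divided out inside the logarithm, so that the integrand is
    nonnegative at the center too, where [ln 0 = 0]. *)
Lemma integral_log_vball c n :
  (\int[mu]_(y in vball c n) (- ln (Q ^ (- n) * v ((y : K) - c)))%:E =
   (Q ^ n * ln Q / (Q - 1))%:E)%E.
Proof.
pose h r := - ln (Q ^ (- n) * r).
have hE i : h (Q ^ (n - i%:Z)) = i%:R * ln Q.
  by rewrite /h -(QzD Hv) (ln_Qz Hv) addKr mulrNz mulNr opprK.
rewrite (@integral_vball _ _ _ _ Hv mu Hmu c n h 0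
  (ln Q * (1 - Q^-1) * Q ^ n) Q^-1) //.
- congr EFin; field; rewrite Q_neq0/= Q1_neq0//.
- by apply: measurable_funN; exact: measurable_ln_shift.
- by rewrite !mulr_ge0// ltW// Qn0.
- move=> r /andP[r0 rn]; rewrite oppr_ge0 ln_le0//.
  by rewrite -invr_expz mulrC ler_pdivrMr// mul1r.
- move=> i; rewrite hE (QzD Hv) -[Q ^ (- i%:Z)]invr_expz -exprnP exprVn.
  by field; rewrite ?expf_neq0// Q_neq0.
Qed.

(** The kernel of the truncated operator with [eps = q ^ n], as a function of the
    absolute value and before multiplication by [c1 d1]. *)
Definition pre_kernel n r : R :=
  if r < Q ^ n then Q ^ (- n) * (ln Q / (Q - 1) - ln (Q ^ (- n) * r)) else 0.

Lemma pre_kernel_ge0 n r : 0 <= r -> 0 <= pre_kernel n r.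
Proof.
move=> r0; rewrite /pre_kernel; case: ifP => // rn.
rewrite mulr_ge0 ?(ltW (Qn0 _))// subr_ge0 (@le_trans _ _ 0)//.
  by rewrite ln_le0// -invr_expz mulrC ler_pdivrMr// mul1r ltW.
by rewrite divr_ge0// ltW.
Qed.

Lemma measurable_pre_kernel n : measurable_fun setT (pre_kernel n).
Proof.
apply: measurable_fun_if => //.
- exact: measurable_fun_ltr.
- rewrite setTI; apply: measurable_funTS.
  apply: measurable_funM => //; apply: measurable_funB => //.
  exact: measurable_ln_shift.
Qed.

(** The mass does not depend on [n]; it is the inverse of [c1 * d1], see [c1d1E]. *)
Lemma integral_pre_kernel n x :
  (\int[mu]_z (pre_kernel n (v (x - (z : K))))%:E =
   (ln Q * (Q + 1) / (Q * (Q - 1)))%:E)%E.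
Proof.
pose h r := Q ^ (- n) * (ln Q / (Q - 1) - ln (Q ^ (- n) * r)).
transitivity (\int[mu]_(z in vball x (n - 1)) (h (v ((z : K) - x)))%:E)%E.
  rewrite [RHS]integral_mkcond; apply: eq_integral => z _.
  rewrite patchE (v_sub Hv) /pre_kernel; case: ifPn => zn.
    by rewrite mem_set// /vball/= -(v_lt_Qz Hv).
  by rewrite memNset// /vball/= -(v_lt_Qz Hv); exact/negP.
rewrite (@integral_vball _ _ _ _ Hv mu Hmu x (n - 1) h
  (ln Q * (1 - Q^-1) * Q^-1 * ((Q - 1)^-1 + 1))
  (ln Q * (1 - Q^-1) * Q^-1) Q^-1) //.
- by congr EFin; field; rewrite Q_neq0/= Q1_neq0.
- apply: measurable_funM => //; apply: measurable_funB => //.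
  exact: measurable_ln_shift.
- by rewrite !mulr_ge0// ?addr_ge0// ?invr_ge0// ltW.
- by rewrite !mulr_ge0// ?invr_ge0// ltW.
- move=> r /andP[r0 rn].
  have rn' : r < Q ^ n by rewrite (le_lt_trans rn)// (ltr_Qz Hv); lia.
  by have := pre_kernel_ge0 n r0; rewrite /pre_kernel rn'.
- move=> i; rewrite /h -(QzD Hv) (ln_Qz Hv).
  rewrite (_ : - n + (n - 1 - i%:Z) = - (i%:Z + 1)); last by lia.
  rewrite mulrNz mulNr opprK intrD (QzD Hv) -[Q ^ (- i%:Z)]invr_expz -exprnP exprVn.
  rewrite (QzD Hv) exprN1 -[Q ^ (- n)]invr_expz.
  by field; rewrite ?expf_neq0// Q_neq0 Q1_neq0 Qn_neq0.
Qed.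

End Kernel.

Section LogDifference.
Context {R : realType} {K : topologicalFieldType}.
Variables (v : K -> R) (q : nat).
Hypothesis Hv : normalized_abs v q.
Variable mu : {measure set (borel K) -> \bar R}.
Hypothesis Hmu : normalized_haar v mu.
Implicit Types (x y z w c : K) (m n : int) (r : R).
Local Notation Q := (q%:R : R).
Local Notation vball := (vball v q).
Local Notation outside c n := (outside_ball v (Q ^ n) c : set (borel K)).

Let Q0 : 0 < Q := Q_gt0 Hv.
Let Qn0 n : 0 < Q ^ n := Qz_gt0 Hv n.
Let l0 : 0 < ln Q := lnQ_gt0 Hv.
Let Q1 : 0 < Q - 1. Proof. by rewrite subr_gt0 (Q_gt1 Hv). Qed.
Let Qn_neq0 n : Q ^ n != 0 := lt0r_neq0 (Qn0 n).

(** The integrand of the truncated operator applied to [ln |. - z|], extended by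
    zero inside the ball; integrating it over [w] gives the kernel at [x - z]. *)
Definition log_diff n x z w : R :=
  \1_(outside x n) w * ((ln (v (w - z)) - ln (v (x - z))) / v (w - x) ^+ 2).

Lemma measurable_log_diff n x :
  measurable_fun setT (fun p : borel K * borel K => log_diff n x p.2 p.1).
Proof.
have mln (f : borel K * borel K -> R) : measurable_fun setT f ->
    measurable_fun setT (fun p => ln (f p)).
  by move=> mf; apply: measurableT_comp => //; exact: measurable_ln.
have mx : measurable_fun setT (fun p : borel K * borel K => v ((p.1 : K) - x)).
  exact: (measurableT_comp (measurable_v Hv x) measurable_fst).
apply: measurable_funM.
  have mi : measurable_fun setT (\1_(outside x n) : borel K -> R).
    by apply: measurable_indic; exact: measurable_outside.
  exact: (measurableT_comp mi measurable_fst).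
apply: measurable_funM.
  apply: measurable_funB; first by apply: mln; exact: (measurable_v_sub Hv).
  apply: mln; under eq_fun do rewrite (v_sub Hv).
  exact: (measurableT_comp (measurable_v Hv x) measurable_snd).
by apply: measurableT_comp; [exact: measurable_invr|exact: measurable_funX].
Qed.

Lemma measurable_log_diff1 n x z :
  measurable_fun setT (fun w : borel K => log_diff n x z w).
Proof.
exact: (measurableT_comp (measurable_log_diff n x)
  (@pair2_measurable _ _ (borel K) (borel K) (z : borel K))).
Qed.

(** What remains of [log_diff] on [|w - x| > |x - z| = q ^ m]. *)
Definition outer_part m x w : R :=
  \1_(outside x m) w * ((ln (v (w - x)) - ln (Q ^ m)) / v (w - x) ^+ 2).
(** What [log_diff] subtracts on [|w - z| < |x - z| = q ^ m]. *)
Definition inner_part m z w : R :=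
  \1_(vball z m) w * (- ln (Q ^ (- m) * v (w - z))) / (Q ^ m) ^+ 2.

(** The ultrametric inequality decides the value in each of the three ranges of
    [|w - x|] compared to [|x - z|]. The point [w = z] has to be left out, as
    [ln 0] has a conventional value there. *)
Lemma log_diff_far n m x z w : n <= m -> v (x - z) = Q ^ m -> w != z ->
  log_diff n x z w = outer_part m x w - inner_part m z w.
Proof.
move=> nm xz wz; have wz0 : 0 < v (w - z) by rewrite (v_gt0 Hv) subr_eq0.
rewrite /log_diff /outer_part /inner_part !indicE (ln_QzM Hv _ wz0) xz !(ln_Qz Hv).
have wE : w - z = w - x + (x - z) by rewrite subrKA.
have inO k : (w \in outside x k) = (Q ^ k <= v (w - x)).
  by apply/idP/idP => [/set_mem//|wk]; apply/mem_set.
have inB : (w \in vball z m) = (v (w - z) <= Q ^ m).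
  by apply/idP/idP => [/set_mem//|wk]; apply/mem_set.
rewrite !inO inB.
have [wx|wx|wx] := ltgtP (v (w - x)) (Q ^ m).
- have -> : v (w - z) = Q ^ m by rewrite wE (v_dominant Hv) xz.
  by rewrite lexx (ln_Qz Hv) subrr /= !(mulr0n, mul0r, mulr0, oppr0, subr0).
- have vwz : v (w - z) = v (w - x) by rewrite wE addrC (@v_dominant _ _ _ _ Hv (x - z) (w - x)) ?xz.
  rewrite vwz [v (w - x) <= _]leNgt wx /= (le_trans _ (ltW wx)) ?(ler_Qz Hv)//.
  by rewrite /= !(mulr0n, mul0r, subr0).
- have -> : v (w - z) <= Q ^ m by rewrite wE (v_le_add Hv)// ?xz ?wx.
  rewrite wx (ler_Qz Hv) nm /= !(mulr0n, mulr1n, mul1r).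
  by rewrite (ln_Qz Hv) subrr mul0r sub0r mulNr opprK.
Qed.

(** Here [|x - z| < |w - x|], hence [|w - z| = |w - x|]. *)
Lemma log_diff_near n m x z w : m < n -> v (x - z) = Q ^ m ->
  log_diff n x z w =
    \1_(outside x n) w * ((ln (v (w - x)) - ln (Q ^ m)) / v (w - x) ^+ 2).
Proof.
move=> mn xz; rewrite /log_diff !indicE xz.
case: (boolP (w \in _)) => [/set_mem wx|_]; last by rewrite !mul0r.
rewrite (_ : v (w - z) = v (w - x))// -(subrKA x w) addrC.
rewrite (@v_dominant _ _ _ _ Hv (x - z) (w - x)) ?xz//.
by rewrite (lt_le_trans _ wx)// (ltr_Qz Hv).
Qed.

Lemma measurable_outer_part m x : measurable_fun setT (outer_part m x : borel K -> R).
Proof.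
apply: measurable_funM.
  by apply: measurable_indic; exact: measurable_outside.
have mx := measurable_v Hv x.
apply: measurable_funM.
  by apply: measurable_funB => //; apply: measurableT_comp => //; exact: measurable_ln.
by apply: measurableT_comp; [exact: measurable_invr|exact: measurable_funX].
Qed.

Lemma measurable_inner_part m z : measurable_fun setT (inner_part m z : borel K -> R).
Proof.
apply: measurable_funM => //; apply: measurable_funM.
  by apply: measurable_indic; exact: measurable_vball.
apply: measurable_funN.
exact: (measurableT_comp (measurable_ln_shift (Q ^ (- m))) (measurable_v Hv z)).
Qed.

Lemma outer_part_ge0 m x w : 0 <= outer_part m x w.
Proof.
rewrite /outer_part indicE; case: (boolP (w \in _)) => [/set_mem wx|]; last by rewrite mul0r.
rewrite mul1r divr_ge0 ?exprn_ge0 ?(abs_ge0 Hv)// subr_ge0 ler_ln ?posrE//.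
exact: lt_le_trans wx.
Qed.

Lemma inner_part_ge0 m x w : 0 <= inner_part m x w.
Proof.
rewrite /inner_part indicE; case: (boolP (w \in _)) => [/set_mem wx|]; last by rewrite !mul0r.
rewrite mul1r divr_ge0 ?exprn_ge0 ?(ltW (Qn0 _))// oppr_ge0 ln_le0//.
by rewrite -invr_expz mulrC ler_pdivrMr// mul1r.
Qed.

Lemma integral_outer_part m x :
  (\int[mu]_w (outer_part m x w)%:E = (Q ^ (- m) * ln Q / (Q - 1))%:E)%E.
Proof.
by rewrite integral_indicM (integral_log_outside Hv Hmu)// subrr add0r.
Qed.

(** The same value as for [outer_part]: this coincidence is the reason why the
    kernel is supported in the ball of radius [eps]. *)
Lemma integral_inner_part m z :
  (\int[mu]_w (inner_part m z w)%:E = (Q ^ (- m) * ln Q / (Q - 1))%:E)%E.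
Proof.
rewrite /inner_part; under eq_integral do rewrite -mulrA.
rewrite integral_indicM.
under eq_integral do rewrite mulrC EFinM.
rewrite ge0_integralZl_EFin//.
- rewrite (integral_log_vball Hv Hmu) -EFinM; congr EFin.
  by rewrite -invr_expz; field; rewrite Qn_neq0 lt0r_neq0.
- exact: measurable_vball.
- move=> w wz; rewrite lee_fin oppr_ge0 ln_le0//.
  by rewrite -invr_expz mulrC ler_pdivrMr// mul1r.
- apply/measurable_EFinP; apply: measurable_funN; apply: measurable_funTS.
  exact: (measurableT_comp (measurable_ln_shift (Q ^ (- m))) (measurable_v Hv z)).
- by rewrite invr_ge0 exprn_ge0// ltW.
Qed.

Lemma ge0_integrable (f : borel K -> R) : measurable_fun setT f ->
  (forall w, 0 <= f w) -> (\int[mu]_w (f w)%:E < +oo)%E ->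
  mu.-integrable setT (EFin \o f).
Proof.
move=> mf f0 foo; apply/integrableP; split; first exact/measurable_EFinP.
by under eq_integral do rewrite /= ger0_norm//.
Qed.

Lemma ae_neq z : {ae mu, forall w : borel K, (w : K) != z}.
Proof.
exists [set z : borel K]; split; first exact: measurable_set1K Hv z.
  exact (haar_set1 Hv Hmu z).
by move=> w /negP; rewrite negbK => /eqP.
Qed.

(** Bound used for the exchange of integrals: the two parts do not cancel in
    absolute value, but they contribute a constant, at most the value for the
    smallest radius [q ^ m = q ^ n]. *)
Lemma log_diff_abs_integral n x z : x != z ->
  (\int[mu]_w `|(log_diff n x z w)%:E| <=
     (Q ^ (- n) * ln Q / (Q - 1) *+ 2 + pre_kernel q n (v (x - z)))%:E)%E.
Proof.
move=> xz; have [m vxz] := v_Qz Hv (ltac:(by rewrite subr_eq0) : x - z != 0).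
have mE := measurable_log_diff1 n x z.
rewrite /pre_kernel vxz (ltr_Qz Hv); have [nm|mn] := leP n m; last first.
  rewrite (eq_integral (fun w : borel K => (\1_(outside x n) w *
      ((ln (v ((w : K) - x)) - ln (Q ^ m)) / v ((w : K) - x) ^+ 2))%:E)).
    rewrite integral_indicM (integral_log_outside Hv Hmu) ?(ltW mn)// lee_fin.
    rewrite -(QzD Hv) (ln_Qz Hv) (_ : (- n + m)%:~R = - (n - m)%:~R); last first.
      by rewrite -mulrNz opprB addrC.
    rewrite mulNr opprK -mulrA mulrDr [ln Q * _ + _]addrC [ln Q * _%:~R]mulrC.
    by rewrite lerDr mulrn_wge0// divr_ge0 ?mulr_ge0// ltW.
  move=> w _; rewrite (log_diff_near w mn vxz) /= ger0_norm// indicE.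
  case: (boolP (w \in _)) => [/set_mem wx|]; last by rewrite mul0r.
  rewrite mul1r divr_ge0 ?exprn_ge0 ?(abs_ge0 Hv)// subr_ge0 ler_ln ?posrE//.
    by rewrite (le_trans _ wx)// (ler_Qz Hv) ltW.
  exact: lt_le_trans wx.
apply: (@le_trans _ _ (\int[mu]_w ((outer_part m x w)%:E + (inner_part m z w)%:E)%E)%E).
  apply: ae_ge0_le_integral => //.
  - by apply: measurableT_comp => //; exact/measurable_EFinP.
  - by move=> w _; rewrite -EFinD lee_fin addr_ge0 ?outer_part_ge0 ?inner_part_ge0.
  - apply: emeasurable_funD; apply/measurable_EFinP;
      [exact: measurable_outer_part|exact: measurable_inner_part].
  - apply: filterS (ae_neq z) => w wz _.
    rewrite (log_diff_far nm vxz wz) -EFinD abse_EFin lee_fin.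
    by rewrite (le_trans (ler_normB _ _))// !ger0_norm ?outer_part_ge0 ?inner_part_ge0.
rewrite ge0_integralD//.
- rewrite integral_outer_part integral_inner_part -EFinD lee_fin addr0 mulr2n lerD//.
    by rewrite !ler_pM2r ?invr_gt0// (ler_Qz Hv) lerN2.
  by rewrite !ler_pM2r ?invr_gt0// (ler_Qz Hv) lerN2.
- by move=> w _; rewrite lee_fin outer_part_ge0.
- by apply/measurable_EFinP; exact: measurable_outer_part.
- by move=> w _; rewrite lee_fin inner_part_ge0.
- by apply/measurable_EFinP; exact: measurable_inner_part.
Qed.

Lemma log_diff_integral n x z : x != z ->
  (\int[mu]_w (log_diff n x z w)%:E = (pre_kernel q n (v (x - z)))%:E)%E.
Proof.
move=> xz; have [m vxz] := v_Qz Hv (ltac:(by rewrite subr_eq0) : x - z != 0).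
have mE := measurable_log_diff1 n x z.
rewrite /pre_kernel vxz (ltr_Qz Hv); have [nm|mn] := leP n m; last first.
  rewrite (eq_integral (fun w : borel K => (\1_(outside x n) w *
      ((ln (v ((w : K) - x)) - ln (Q ^ m)) / v ((w : K) - x) ^+ 2))%:E)).
    rewrite integral_indicM (integral_log_outside Hv Hmu) ?(ltW mn)//.
    rewrite -(QzD Hv) (ln_Qz Hv) (_ : (- n + m)%:~R = - (n - m)%:~R); last first.
      by rewrite -mulrNz opprB addrC.
    by rewrite mulNr opprK -mulrA mulrDr [ln Q * _ + _]addrC [ln Q * _%:~R]mulrC.
  by move=> w _; rewrite (log_diff_near w mn vxz).
have i1 : mu.-integrable setT (EFin \o (outer_part m x : borel K -> R)).
  apply: ge0_integrable; [exact: measurable_outer_part|exact: outer_part_ge0|].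
  by rewrite integral_outer_part ltry.
have i2 : mu.-integrable setT (EFin \o (inner_part m z : borel K -> R)).
  apply: ge0_integrable; [exact: measurable_inner_part|exact: inner_part_ge0|].
  by rewrite integral_inner_part ltry.
rewrite (ae_eq_integral (fun w : borel K => (outer_part m x w)%:E - (inner_part m z w)%:E)%E)//.
- rewrite integralB_EFin// integral_outer_part integral_inner_part subee//.
- exact/measurable_EFinP.
- apply: emeasurable_funB; apply/measurable_EFinP;
    [exact: measurable_outer_part|exact: measurable_inner_part].
- apply: filterS (ae_neq z) => w wz _.
  by rewrite -EFinB (log_diff_far nm vxz wz).
Qed.

End LogDifference.

(** * Integrability against the logarithm *)

Section LogIntegrable.
Context {R : realType} {K : topologicalFieldType}.
Variables (v : K -> R) (q : nat).
Hypothesis Hv : normalized_abs v q.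
Variable mu : {measure set (borel K) -> \bar R}.
Implicit Types (x y z w c : K) (m n : int) (r : R) (f : K -> R).
Local Notation Q := (q%:R : R).

Let Q0 : 0 < Q := Q_gt0 Hv.
Let Qn0 n : 0 < Q ^ n := Qz_gt0 Hv n.
Let l0 : 0 < ln Q := lnQ_gt0 Hv.
Let Q1 : 0 < Q - 1. Proof. by rewrite subr_gt0 (Q_gt1 Hv). Qed.

(** Dominates the logarithm, the constants and the kernel at once. *)
Definition log_weight x z : R := 1 + `|ln (v (x - z))|.

(** What the potential and its truncated difference quotients need in order to be
    absolutely convergent at every point. *)
Definition log_integrable f : Prop :=
  measurable_fun [set: borel K] (f : borel K -> R) /\
  forall x, (\int[mu]_z (`|f z| * log_weight x z)%:E < +oo)%E.

Lemma log_weight_ge1 x z : 1 <= log_weight x z.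
Proof. by rewrite lerDl. Qed.

Lemma log_weight_ge0 x z : 0 <= log_weight x z.
Proof. exact: le_trans (log_weight_ge1 x z). Qed.

Lemma measurable_v_subl x : measurable_fun setT (fun z : borel K => v (x - (z : K))).
Proof. by under eq_fun do rewrite (v_sub Hv); exact: (measurable_v Hv x). Qed.

Lemma measurable_ln_v x :
  measurable_fun setT (fun z : borel K => ln (v (x - (z : K)))).
Proof.
exact: (measurableT_comp (@measurable_ln R) (measurable_v_subl x)).
Qed.

Lemma measurable_log_weight x :
  measurable_fun setT (log_weight x : borel K -> R).
Proof.
apply: measurable_funD => //; apply: measurableT_comp => //.
exact: measurable_ln_v.
Qed.

Lemma log_integrable_mul f x (k : K -> R) (A : R) : log_integrable f ->
  measurable_fun setT (k : borel K -> R) ->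
  (forall z, `|k z| <= A * log_weight x z) ->
  mu.-integrable setT (fun z : borel K => (k z * f z)%:E).
Proof.
move=> [mf fx] mk kA.
have mp : measurable_fun setT (fun z : borel K => (`|f z| * log_weight x z)%:E).
  apply/measurable_EFinP; apply: measurable_funM; last exact: measurable_log_weight.
  exact: measurableT_comp.
have p0 z : 0 <= `|f z| * log_weight x z by rewrite mulr_ge0// log_weight_ge0.
have ip : mu.-integrable setT (fun z : borel K => (`|f z| * log_weight x z)%:E).
  apply/integrableP; split => //.
  by under eq_integral do rewrite abse_EFin ger0_norm//.
apply: (le_integrable measurableT _ _ (integrableZl measurableT A ip)) => //.
  by apply/measurable_EFinP; exact: measurable_funM.
move=> z _ /=; rewrite lee_fin normrM mulrC.
have A0 : 0 <= A.
  by rewrite -(pmulr_lge0 _ (lt_le_trans ltr01 (log_weight_ge1 x z))) (le_trans _ (kA z)).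
rewrite [leRHS]ger0_norm; last by apply: mulr_ge0 => //; exact: p0.
by rewrite mulrCA ler_wpM2l.
Qed.

Lemma log_integrable_integrable f : log_integrable f ->
  mu.-integrable setT (fun z : borel K => (f z)%:E).
Proof.
move=> lf; have := @log_integrable_mul f 0 (cst 1) 1 lf (measurable_cst _).
under eq_fun do rewrite /= mul1r; apply => z.
by rewrite normr1 mul1r log_weight_ge1.
Qed.

Lemma log_integrable_riesz f x : log_integrable f ->
  mu.-integrable setT (fun z : borel K => (ln (v (x - z)) * f z)%:E).
Proof.
move=> lf; apply: (@log_integrable_mul f x _ 1) => //.
  exact: measurable_ln_v.
by move=> z; rewrite mul1r lerDr.
Qed.

Lemma measurable_pre_kernel_v n x :
  measurable_fun setT (fun z : borel K => pre_kernel q n (v (x - (z : K)))).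
Proof.
exact: (measurableT_comp (measurable_pre_kernel q n) (measurable_v_subl x)).
Qed.

Lemma pre_kernel_le n : exists2 A, 0 <= A &
  forall x z, pre_kernel q n (v (x - z)) <= A * log_weight x z.
Proof.
(* On its support the kernel is [Q ^ - n] times
   [ln Q / (Q - 1) + n ln Q - ln (v (x - z))]. *)
pose B := ln Q / (Q - 1) + `|n%:~R| * ln Q.
have B0 : 0 <= B by rewrite addr_ge0// ?divr_ge0 ?mulr_ge0// ltW.
have B1 : 0 <= B + 1 by rewrite addr_ge0.
exists (Q ^ (- n) * (B + 1)); first by rewrite mulr_ge0// ltW.
move=> x z; rewrite /pre_kernel; case: ifP => _; last first.
  by rewrite !mulr_ge0 ?log_weight_ge0// ltW.
rewrite -mulrA ler_pM2l//.
apply: (@le_trans _ _ (B + `|ln (v (x - z))|)); last first.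
  rewrite /log_weight; set L := `|_|; have L0 : 0 <= L by exact: normr_ge0.
  by nra.
rewrite /B -addrA lerD2l.
have [->|xz] := eqVneq (x - z) 0.
  rewrite (v_0 Hv) mulr0 ln0// oppr0 normr0 addr0 mulr_ge0// ltW//.
rewrite (ln_QzM Hv) ?(v_gt0 Hv)// opprB lerD//.
  by rewrite ler_pM2r// ler_norm.
by rewrite -normrN ler_norm.
Qed.

Lemma log_integrable_pre_kernel n f x : log_integrable f ->
  mu.-integrable setT (fun z : borel K => (pre_kernel q n (v (x - z)) * f z)%:E).
Proof.
move=> lf; have [A A0 kA] := pre_kernel_le n.
apply: (@log_integrable_mul f x _ A) => //.
  exact: measurable_pre_kernel_v.
by move=> z; rewrite ger0_norm ?(pre_kernel_ge0 Hv) ?(abs_ge0 Hv).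
Qed.

End LogIntegrable.

Section Decay.
Context {R : realType} {K : topologicalFieldType}.
Variables (v : K -> R) (q : nat).
Hypothesis Hv : normalized_abs v q.
Variable mu : {measure set (borel K) -> \bar R}.
Hypothesis Hmu : normalized_haar v mu.
Implicit Types (x y z w c : K) (m n : int) (r : R) (f : K -> R).
Local Notation Q := (q%:R : R).
Local Notation vball := (vball v q).
Local Notation outside c n := (outside_ball v (Q ^ n) c : set (borel K)).

Let Q0 : 0 < Q := Q_gt0 Hv.
Let Qn0 n : 0 < Q ^ n := Qz_gt0 Hv n.
Let l0 : 0 < ln Q := lnQ_gt0 Hv.
Let QV01 : 0 <= Q^-1 < 1.
Proof. by rewrite invr_ge0 (ltW Q0) invf_lt1// (Q_gt1 Hv). Qed.
Let w0 : 0 <= 1 - Q^-1.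
Proof. by rewrite subr_ge0 ltW//; case/andP: QV01. Qed.

Lemma integral_log_weight_vball x (N : nat) (M : R) : 0 <= M ->
  (\int[mu]_(z in vball x N%:Z) (M * log_weight v x z)%:E < +oo)%E.
Proof.
move=> M0.
(* For [r <= Q ^ N] one has [|ln r| <= 2 N ln Q - ln r]; the form chosen here is
   also valid at [r = 0]. *)
pose h r := M * (1 + N%:R * ln Q - ln (Q ^ (- N%:Z) * r)).
have h0 r : 0 <= r <= Q ^ N%:Z -> 0 <= h r.
  move=> /andP[r0 rN]; rewrite mulr_ge0// subr_ge0 (@le_trans _ _ 0)//.
    by rewrite ln_le0// -invr_expz mulrC ler_pdivrMr// mul1r.
  by rewrite addr_ge0// mulr_ge0// ltW.
have mh : measurable_fun setT h.
  by apply: measurable_funM => //; apply: measurable_funB => //; exact: measurable_ln_shift.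
apply: (@le_lt_trans _ _ (\int[mu]_(z in vball x N%:Z) (h (v ((z : K) - x)))%:E)%E).
  apply: ge0_le_integral => //.
  - exact: measurable_vball.
  - by move=> z _; rewrite lee_fin mulr_ge0// log_weight_ge0.
  - apply/measurable_EFinP; apply: measurable_funTS; apply: measurable_funM => //.
    exact: (measurable_log_weight Hv).
  - by apply/measurable_EFinP; apply: measurable_funTS; exact: (measurable_radial Hv).
  move=> z zN; rewrite lee_fin /log_weight (v_sub Hv x) /h ler_wpM2l// -addrA lerD2l.
  have [->|zx] := eqVneq (z - x) 0.
    by rewrite (v_0 Hv) mulr0 ln0// normr0 subr0 mulr_ge0// ltW.
  have vz0 : 0 < v (z - x) by rewrite (v_gt0 Hv).
  have lnz : ln (v (z - x)) <= N%:R * ln Q.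
    by rewrite -[N%:R]/(N%:Z%:~R) -(ln_Qz Hv) ler_ln ?posrE.
  rewrite (ln_QzM Hv)// ler_norml -[N%:Z%:~R]/(N%:R).
  have : 0 <= N%:R * ln Q by rewrite mulr_ge0// ltW.
  by move: lnz => /=; set a := ln _; set b := _ * _ => *; apply/andP; split; lra.
rewrite (@integral_vball _ _ _ _ Hv mu Hmu x N%:Z h
  (M * (1 + N%:R * ln Q) * Q ^ N%:Z * (1 - Q^-1))
  (M * ln Q * Q ^ N%:Z * (1 - Q^-1)) Q^-1) ?ltry//.
- by rewrite !mulr_ge0// ?(ltW (Qn0 _))// addr_ge0// mulr_ge0// ltW.
- by rewrite !mulr_ge0// ltW.
move=> i; rewrite /h -(QzD Hv) (ln_Qz Hv) addKr mulrNz mulNr opprK.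
rewrite (QzD Hv) -[Q ^ (- i%:Z)]invr_expz -!exprnP exprVn.
rewrite -[i%:~R]/(i%:R); field; by rewrite expf_neq0 lt0r_neq0.
Qed.

(** On the spheres of radius [q ^ k] the integrand times the measure is a linear
    function of [k] times [(q ^ (1 - beta)) ^ k], and [beta > 1]. *)
Lemma integral_log_weight_outside x (N : nat) (C beta : R) : 0 <= C -> 1 < beta ->
  (\int[mu]_(z in outside x N.+1%:Z)
     (C * (1 + `|ln (v ((z : K) - x))|) * v ((z : K) - x) `^ (- beta))%:E < +oo)%E.
Proof.
move=> C0 beta1.
pose h r := C * (1 + `|ln r|) * r `^ (- beta).
pose t : R := Q `^ (1 - beta).
have t01 : 0 <= t < 1.
  rewrite powR_ge0/= /t /powR gt_eqF// -[ltRHS]expR0 ltr_expR.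
  by rewrite nmulr_rlt0// subr_lt0.
have QtE (k : nat) : (Q ^+ k) `^ (- beta) * Q ^+ k = t ^+ k.
  rewrite -!powR_mulrn ?powR_ge0 ?ltW// -powRrM -powRD; last first.
    by rewrite (gt_eqF Q0) implybT.
  rewrite -powRrM; congr (_ `^ _); ring.
have mh : measurable_fun setT h.
  apply: measurable_funM; last exact: measurable_powR.
  apply: measurable_funM => //; apply: measurable_funD => //.
  by apply: measurableT_comp => //; exact: measurable_ln.
have hE (i : nat) : h (Q ^ (N.+1%:Z + i%:Z)) * Q ^ (N.+1%:Z + i%:Z) =
    C * (1 + (N.+1%:R + i%:R) * ln Q) * t ^+ N.+1 * t ^+ i.
  rewrite (_ : N.+1%:Z + i%:Z = (N.+1 + i)%N%:Z)// /h (ln_Qz Hv) -!exprnP -!mulrA.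
  rewrite QtE exprD -[_%:~R]/((N.+1 + i)%:R) natrD ger0_norm ?mulr_ge0 ?addr_ge0//.
  exact: ltW.
rewrite (@integral_outside _ _ _ _ Hv mu Hmu x N.+1%:Z h
  (C * (1 + N.+1%:R * ln Q) * t ^+ N.+1 * (1 - Q^-1))
  (C * ln Q * t ^+ N.+1 * (1 - Q^-1)) t) ?ltry//.
- rewrite !mulr_ge0// ?exprn_ge0// ?addr_ge0 ?mulr_ge0//; first exact: ltW.
  by case/andP: t01.
- rewrite !mulr_ge0// ?exprn_ge0//; first exact: ltW.
  by case/andP: t01.
- by move=> i; rewrite !mulr_ge0// ?powR_ge0// addr_ge0.
- by move=> i; rewrite mulrA hE; ring.
Qed.

(** On a ball around [0] that contains [x], the function is bounded and the
    logarithm is integrable; outside, [|z| = |z - x|] by the isosceles principle,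
    so the decay makes the integrand radial around [x]. *)
Lemma log_integrable_decay f (beta C : R) (N0 : int) :
  measurable_fun [set: borel K] (f : borel K -> R) -> 1 < beta ->
  (forall N, exists M, {ae mu, forall y : borel K, vball 0 N y -> `|f y| <= M}) ->
  (forall y, Q ^ N0 <= v y -> `|f y| <= C * v y `^ (- beta)) ->
  log_integrable v mu f.
Proof.
move=> mf beta1 loc decay; split => // x.
have [k kx] := vball_exhaust Hv x.
pose N := (k + `|N0|)%N.
have xN : vball 0 N%:Z x by apply: kx; rewrite /N; lia.
have BE : vball 0 N%:Z = vball x N%:Z by exact: vball_eq.
have [M fM] := loc N%:Z.
have mw : measurable_fun setT (fun z : borel K => (`|f z| * log_weight v x z)%:E).
  apply/measurable_EFinP; apply: measurable_funM; last exact: (measurable_log_weight Hv).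
  exact: measurableT_comp.
have outE : outside x N.+1%:Z = ~` vball x N%:Z.
  by rewrite (outsideE Hv) (_ : N.+1%:Z - 1 = N%:Z)//; lia.
rewrite (_ : setT = vball x N%:Z `|` outside x N.+1%:Z); last first.
  by rewrite outE setUv.
rewrite ge0_integral_setU; first last.
- by rewrite outE; apply/disj_setPCl.
- by move=> z _; rewrite lee_fin mulr_ge0// log_weight_ge0.
- exact: measurable_funTS.
- exact: measurable_outside.
- exact: measurable_vball.
apply: lte_add_pinfty.
- have M0 : 0 <= Num.max M 0 by rewrite le_max lexx orbT.
  apply: le_lt_trans (integral_log_weight_vball x N M0).
  apply: ae_ge0_le_integral => //.
  + exact: measurable_vball.
  + by move=> z _; rewrite lee_fin mulr_ge0// log_weight_ge0.
  + exact: measurable_funTS.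
  + by move=> z _; rewrite lee_fin mulr_ge0// log_weight_ge0.
  + apply/measurable_EFinP; apply: measurable_funTS; apply: measurable_funM => //.
    exact: (measurable_log_weight Hv).
  + apply: filterS fM => z fz; rewrite -BE => /fz fz'.
    by rewrite lee_fin ler_wpM2r ?log_weight_ge0// le_max fz'.
- have C0 : 0 <= Num.max C 0 by rewrite le_max lexx orbT.
  apply: le_lt_trans (integral_log_weight_outside x N C0 beta1).
  apply: ge0_le_integral => //.
  + exact: measurable_outside.
  + by move=> z _; rewrite lee_fin mulr_ge0// log_weight_ge0.
  + exact: measurable_funTS.
  + apply/measurable_EFinP; apply: measurable_funTS.
    apply: (@measurable_radial _ _ _ _ Hv x
      (fun r => Num.max C 0 * (1 + `|ln r|) * r `^ (- beta))).
    apply: measurable_funM; last exact: measurable_powR.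
    apply: measurable_funM => //; apply: measurable_funD => //.
    by apply: measurableT_comp => //; exact: measurable_ln.
  + move=> z xz; rewrite lee_fin /log_weight (v_sub Hv x) mulrAC.
    rewrite ler_wpM2r ?addr_ge0//.
    have vz : v z = v (z - x).
      rewrite -{1}(subrK x z) addrC (@v_dominant _ _ _ _ Hv x (z - x))//.
      apply: (lt_le_trans _ xz); rewrite (v_lt_Qz Hv) (_ : N.+1%:Z - 1 = N%:Z); last by lia.
      by move: xN; rewrite /vball/= subr0.
    rewrite -vz (le_trans (decay z _))//.
      by rewrite vz (le_trans _ xz)// (ler_Qz Hv) /N; lia.
    by rewrite ler_wpM2r ?powR_ge0// le_max lexx.
Qed.

End Decay.

(** * The truncated operator applied to a logarithmic potential *)

(** Sigma-finiteness is a hypothesis here; the structure of sigma-finite measure is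
    packed inside the proof. *)
Lemma sigma_finite_fubini d (T : measurableType d) (R : realType)
    (mu : {measure set T -> \bar R}) (F : T * T -> R) :
  sigma_finite setT mu -> measurable_fun setT F ->
  (\int[mu]_z \int[mu]_w `|(F (w, z))%:E| < +oo)%E ->
  [/\ mu.-integrable setT (fun w => \int[mu]_z (F (w, z))%:E)%E,
      measurable_fun setT (fun z => \int[mu]_w (F (w, z))%:E)%E &
  (\int[mu]_w \int[mu]_z (F (w, z))%:E = \int[mu]_z \int[mu]_w (F (w, z))%:E)%E].
Proof.
move=> sf mF Foo.
pose sfin := isSFinite.Build _ _ _ _ (sfinite_measure_sigma_finite sf).
pose sigfin := isSigmaFinite.Build _ _ _ _ sf.
pose smu : {sigma_finite_measure set T -> \bar R} :=
  HB.pack_for (SigmaFiniteMeasure.type T R) (Measure.sort mu) sfin sigfin.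
have mFE : measurable_fun setT (EFin \o F) by exact/measurable_EFinP.
have iF : (smu \x smu)%E.-integrable setT (EFin \o F).
  exact: (integrable21ltyP smu smu mFE).2 Foo.
split; [exact: (integrable_fubini_F iF)|exact: (measurable_fubini_G iF)|].
exact: Fubini iF.
Qed.

Lemma sigma_finite_tonelli d (T : measurableType d) (R : realType)
    (mu : {measure set T -> \bar R}) (F : T * T -> R) :
  sigma_finite setT mu -> measurable_fun setT F -> (forall p, 0 <= F p) ->
  [/\ measurable_fun setT (fun w => \int[mu]_z (F (w, z))%:E)%E,
      measurable_fun setT (fun z => \int[mu]_w (F (w, z))%:E)%E &
  (\int[mu]_w \int[mu]_z (F (w, z))%:E = \int[mu]_z \int[mu]_w (F (w, z))%:E)%E].
Proof.
move=> sf mF F0.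
pose sfin := isSFinite.Build _ _ _ _ (sfinite_measure_sigma_finite sf).
pose sigfin := isSigmaFinite.Build _ _ _ _ sf.
pose smu : {sigma_finite_measure set T -> \bar R} :=
  HB.pack_for (SigmaFiniteMeasure.type T R) (Measure.sort mu) sfin sigfin.
have mFE : measurable_fun setT (EFin \o F) by exact/measurable_EFinP.
have F0' p : (0 <= (EFin \o F) p)%E by rewrite lee_fin.
split.
- exact: (@measurable_fun_fubini_tonelli_F _ _ _ _ _ smu (EFin \o F)).
- exact: (@measurable_fun_fubini_tonelli_G _ _ _ _ _ smu (EFin \o F)).
- exact: (@fubini_tonelli _ _ _ _ _ smu smu (EFin \o F)).
Qed.

Section FractionalRiesz.
Context {R : realType} {K : topologicalFieldType}.
Variables (v : K -> R) (q : nat).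
Hypothesis Hv : normalized_abs v q.
Variable mu : {measure set (borel K) -> \bar R}.
Hypothesis Hmu : normalized_haar v mu.
Implicit Types (x y z w c : K) (m n : int) (r : R) (f : K -> R).
Local Notation Q := (q%:R : R).
Local Notation outside c n := (outside_ball v (Q ^ n) c : set (borel K)).

Let sf := haar_sigma_finite Hv Hmu.

Definition log_potential f x : R := \int[mu]_z (ln (v (x - (z : K))) * f z).

Lemma log_potentialE f x : log_integrable v mu f ->
  (\int[mu]_z (ln (v (x - (z : K))) * f z)%:E = (log_potential f x)%:E)%E.
Proof.
move=> lf; rewrite /log_potential /Rintegral fineK//.
exact: (integrable_fin_num measurableT (log_integrable_riesz Hv x lf)).
Qed.

Lemma log_diff_mul_abs_integral f n x : log_integrable v mu f ->
  (\int[mu]_z \int[mu]_w `|(log_diff v q n x z w * f z)%:E| < +oo)%E.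
Proof.
move=> lf; have [A A0 kA] := pre_kernel_le Hv n.
pose B := Q ^ (- n) * ln Q / (Q - 1) *+ 2.
have B0 : 0 <= B.
  rewrite mulrn_wge0// divr_ge0 ?mulr_ge0// ltW ?(Qz_gt0 Hv) ?(lnQ_gt0 Hv)//.
  by rewrite subr_gt0 (Q_gt1 Hv).
have mf := lf.1.
have mF : measurable_fun setT (fun p : borel K * borel K =>
    `|log_diff v q n x p.2 p.1 * f p.2|).
  apply: measurableT_comp => //; apply: measurable_funM.
    exact: measurable_log_diff Hv n x.
  exact: (measurableT_comp mf measurable_snd).
have [_ mG _] := sigma_finite_tonelli sf mF (fun p => normr_ge0 _).
pose g z : R := (B + A) * (`|f z| * log_weight v x z).
have BA0 : 0 <= B + A by exact: addr_ge0.
have p0 z : 0 <= `|f z| * log_weight v x z.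
  by apply: mulr_ge0 => //; exact: log_weight_ge0.
have g0 z : (0 <= (g z)%:E)%E by rewrite lee_fin; exact: mulr_ge0.
apply: (@le_lt_trans _ _ (\int[mu]_z (g z)%:E)%E).
  apply: ae_ge0_le_integral => //.
  - by move=> z _; apply: integral_ge0.
  - apply/measurable_EFinP; apply: measurable_funM => //; apply: measurable_funM.
      exact: measurableT_comp.
    exact: measurable_log_weight Hv x.
  - apply: filterS (ae_neq Hv Hmu x) => z zx _.
    under eq_integral do rewrite EFinM abseM muleC.
    rewrite ge0_integralZl//; last first.
      apply: measurableT_comp => //; apply/measurable_EFinP.
      exact: measurable_log_diff1.
    apply: (@le_trans _ _ (`|f z|%:E * (B + pre_kernel q n (v (x - z)))%:E)%E).
      by rewrite lee_wpmul2l// log_diff_abs_integral// eq_sym.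
    rewrite -EFinM lee_fin /g mulrCA ler_wpM2l// mulrDl lerD//.
    by rewrite ler_peMr// log_weight_ge1.
rewrite /g; under eq_integral do rewrite EFinM.
rewrite ge0_integralZl//.
- by rewrite lte_mul_pinfty//; exact: lf.2.
- apply/measurable_EFinP; apply: measurable_funM; last exact: measurable_log_weight Hv x.
  exact: measurableT_comp.
- by move=> z _; rewrite lee_fin; exact: p0.
Qed.

(** Fubini for [log_diff v q n x z w * f z]: integrating over [z] first gives the
    truncated difference quotient, integrating over [w] first gives the kernel. *)
Lemma frac_log_potential f n x : log_integrable v mu f ->
  mu.-integrable (outside x n) (fun w : borel K =>
    ((log_potential f w - log_potential f x) / v ((w : K) - x) ^+ 2)%:E) /\
  \int[mu]_(w in outside x n)
    ((log_potential f w - log_potential f x) / v ((w : K) - x) ^+ 2) =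
  \int[mu]_z (pre_kernel q n (v (x - (z : K))) * f z).
Proof.
move=> lf; have mf := lf.1.
have mF : measurable_fun setT (fun p : borel K * borel K =>
    log_diff v q n x p.2 p.1 * f p.2).
  apply: measurable_funM; first exact: measurable_log_diff Hv n x.
  exact: (measurableT_comp mf measurable_snd).
have [iW mZ WZ] := sigma_finite_fubini sf mF (log_diff_mul_abs_integral n x lf).
have intz (w : borel K) : (\int[mu]_z (log_diff v q n x z w * f z)%:E =
    (\1_(outside x n) w * ((log_potential f w - log_potential f x) /
      v ((w : K) - x) ^+ 2))%:E)%E.
  transitivity (\int[mu]_z ((\1_(outside x n) w / v ((w : K) - x) ^+ 2)%:E *
      ((ln (v ((w : K) - z)) * f z)%:E - (ln (v (x - z)) * f z)%:E)))%E.
    apply: eq_integral => z _; rewrite -EFinB -EFinM; congr EFin.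
    by rewrite /log_diff -mulrBl !mulrA; ring.
  rewrite integralZl//; last first.
    apply: integrableB => //; first exact (log_integrable_riesz Hv w lf).
    exact (log_integrable_riesz Hv x lf).
  rewrite integralB_EFin//; first last.
  - exact (log_integrable_riesz Hv x lf).
  - exact (log_integrable_riesz Hv w lf).
  by rewrite !log_potentialE// -EFinB -EFinM; congr EFin; ring.
pose g (w : borel K) :=
  (log_potential f w - log_potential f x) / v ((w : K) - x) ^+ 2.
have gE : (fun w : borel K => \int[mu]_z (log_diff v q n x z w * f z)%:E)%E =
    (EFin \o g) \_ (outside x n).
  apply/funext => w; rewrite intz patchE indicE /g.
  by case: (w \in _); rewrite /= ?mul1r ?mul0r.
split.
  apply/(integrable_mkcond (EFin \o g) (measurable_outside Hv x n)).
  by rewrite -gE.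
rewrite /Rintegral; congr fine.
rewrite [LHS]integral_mkcond -[X in integral _ _ X]gE WZ.
apply: ae_eq_integral => //.
  apply/measurable_EFinP; apply: measurable_funM => //.
  exact: measurable_pre_kernel_v.
apply: filterS (ae_neq Hv Hmu x) => z zx _.
rewrite /=; under eq_integral do rewrite mulrC EFinM.
rewrite integralZl//; last first.
  apply/integrableP; split.
    by apply/measurable_EFinP; exact: measurable_log_diff1.
  by apply: le_lt_trans (log_diff_abs_integral Hv Hmu n _) _; rewrite ?ltry// eq_sym.
by rewrite (log_diff_integral Hv Hmu) 1?eq_sym// muleC.
Qed.

End FractionalRiesz.

(** * Mean oscillation against the approximate identity *)

Section ApproximateIdentity.
Context {R : realType} {K : topologicalFieldType}.
Variables (v : K -> R) (q : nat).
Hypothesis Hv : normalized_abs v q.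
Variable mu : {measure set (borel K) -> \bar R}.
Hypothesis Hmu : normalized_haar v mu.
Implicit Types (x y z w c : K) (m n : int) (r : R) (f g h : K -> R).
Local Notation Q := (q%:R : R).

Let sf := haar_sigma_finite Hv Hmu.
Let Q0 : 0 < Q := Q_gt0 Hv.
Let l0 : 0 < ln Q := lnQ_gt0 Hv.
Let Q1 : 0 < Q - 1. Proof. by rewrite subr_gt0 (Q_gt1 Hv). Qed.

Definition diff_kernel n r : R := c1 q * d1 q * pre_kernel q n r.

Lemma c1d1E : c1 q * d1 q = Q * (Q - 1) / (ln Q * (Q + 1)) :> R.
Proof.
have Qp : 0 < Q + 1 by rewrite addr_gt0.
have QQ : Q ^+ 2 - 1 != 0 by rewrite lt0r_neq0// subr_gt0 exprn_egt1// (Q_gt1 Hv).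
rewrite /c1 /d1; field.
by rewrite -?expr2 !lt0r_neq0// subr_gt0 exprn_egt1// (Q_gt1 Hv).
Qed.

Lemma c1d1_ge0 : 0 <= c1 q * d1 q :> R.
Proof.
have Qp : 0 < Q + 1 by rewrite addr_gt0.
by rewrite c1d1E ltW// divr_gt0// mulr_gt0.
Qed.

Lemma kernel_ge0 n x z : 0 <= diff_kernel n (v (x - z)).
Proof. by rewrite mulr_ge0 ?c1d1_ge0 ?(pre_kernel_ge0 Hv) ?(abs_ge0 Hv). Qed.

Lemma kernel_eq0 n r : Q ^ n <= r -> diff_kernel n r = 0.
Proof. by move=> nr; rewrite /diff_kernel /pre_kernel ltNge nr mulr0. Qed.

Lemma measurable_diff_kernel n : measurable_fun setT (diff_kernel n).
Proof. by apply: measurable_funM => //; exact: measurable_pre_kernel. Qed.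

Lemma measurable_kernel_v n x :
  measurable_fun setT (fun z : borel K => diff_kernel n (v (x - (z : K)))).
Proof. exact: (measurableT_comp (measurable_diff_kernel n) (measurable_v_subl Hv x)). Qed.

Lemma measurable_kernel_sub n :
  measurable_fun setT (fun p : borel K * borel K => diff_kernel n (v ((p.1 : K) - (p.2 : K)))).
Proof. exact: (measurableT_comp (measurable_diff_kernel n) (measurable_v_sub Hv)). Qed.

Lemma integral_kernel n x : (\int[mu]_z (diff_kernel n (v (x - (z : K))))%:E = 1)%E.
Proof.
rewrite /diff_kernel; under eq_integral do rewrite EFinM.
rewrite ge0_integralZl_EFin//; last 3 first.
- by move=> z _; rewrite lee_fin (pre_kernel_ge0 Hv) ?(abs_ge0 Hv).
- by apply/measurable_EFinP; exact: measurable_pre_kernel_v.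
- exact: c1d1_ge0.
rewrite (integral_pre_kernel Hv Hmu) -EFinM c1d1E; congr EFin.
by field; rewrite !lt0r_neq0// addr_gt0.
Qed.

Lemma integral_kernel_sym n z : (\int[mu]_x (diff_kernel n (v ((x : K) - z)))%:E = 1)%E.
Proof. by under eq_integral do rewrite (v_sub Hv); exact: integral_kernel. Qed.

(** The double integral that bounds the [L^1] distance between a function and
    its convolution with the kernel, see [convolution_sub_L1]. *)
Definition oscillation n f : \bar R :=
  (\int[mu]_x \int[mu]_z (`|f z - f x| * diff_kernel n (v (x - z)))%:E)%E.

Local Notation mfun f := (measurable_fun [set: borel K] (f : borel K -> R)).

Lemma measurable_oscillation_integrand n f : mfun f ->
  measurable_fun setT (fun p : borel K * borel K =>
    `|f p.2 - f p.1| * diff_kernel n (v ((p.1 : K) - (p.2 : K)))).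
Proof.
move=> mf; apply: measurable_funM; last exact: measurable_kernel_sub.
apply: measurableT_comp => //; apply: measurable_funB.
  exact: (measurableT_comp mf measurable_snd).
exact: (measurableT_comp mf measurable_fst).
Qed.

Lemma oscillation_integrand_ge0 n f x z : 0 <= `|f z - f x| * diff_kernel n (v (x - z)).
Proof. by rewrite mulr_ge0// kernel_ge0. Qed.

Lemma measurable_oscillation_inner n f : mfun f ->
  measurable_fun setT (fun x : borel K =>
    \int[mu]_z (`|f z - f x| * diff_kernel n (v (x - (z : K))))%:E)%E.
Proof.
move=> mf.
by have [] := sigma_finite_tonelli sf (measurable_oscillation_integrand n mf)
  (fun p => oscillation_integrand_ge0 n f p.1 p.2).
Qed.

Lemma measurable_oscillation_integrand1 n f x : mfun f ->
  measurable_fun setT (fun z : borel K => (`|f z - f x| * diff_kernel n (v (x - (z : K))))%:E).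
Proof.
move=> mf; apply/measurable_EFinP.
exact: (measurableT_comp (measurable_oscillation_integrand n mf)
  (@pair1_measurable _ _ (borel K) (borel K) (x : borel K))).
Qed.

Lemma oscillation_dom n f g h : mfun f -> mfun g -> mfun h ->
  (forall x z, `|h z - h x| <= `|f z - f x| + `|g z - g x|) ->
  (oscillation n h <= oscillation n f + oscillation n g)%E.
Proof.
move=> mf mg mh hfg; rewrite /oscillation -ge0_integralD//; first last.
- exact: measurable_oscillation_inner.
- by move=> x _; apply: integral_ge0 => z _; rewrite lee_fin oscillation_integrand_ge0.
- exact: measurable_oscillation_inner.
- by move=> x _; apply: integral_ge0 => z _; rewrite lee_fin oscillation_integrand_ge0.
apply: ge0_le_integral => //.
- by move=> x _; apply: integral_ge0 => z _; rewrite lee_fin oscillation_integrand_ge0.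
- exact: measurable_oscillation_inner.
- by apply: emeasurable_funD; exact: measurable_oscillation_inner.
move=> x _; rewrite -ge0_integralD//; first last.
- exact: measurable_oscillation_integrand1.
- by move=> z _; rewrite lee_fin oscillation_integrand_ge0.
- exact: measurable_oscillation_integrand1.
- by move=> z _; rewrite lee_fin oscillation_integrand_ge0.
apply: ge0_le_integral => //.
- by move=> z _; rewrite lee_fin oscillation_integrand_ge0.
- exact: measurable_oscillation_integrand1.
- by apply: emeasurable_funD; exact: measurable_oscillation_integrand1.
by move=> z _; rewrite -EFinD lee_fin -mulrDl ler_wpM2r// kernel_ge0.
Qed.

Lemma integral_kernel_mull n f : mfun f ->
  (\int[mu]_x \int[mu]_z (`|f z| * diff_kernel n (v ((x : K) - (z : K))))%:E =
   \int[mu]_z `|(f z)%:E|)%E.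
Proof.
move=> mf.
have mF : measurable_fun setT (fun p : borel K * borel K =>
    `|f p.2| * diff_kernel n (v ((p.1 : K) - (p.2 : K)))).
  apply: measurable_funM; last exact: measurable_kernel_sub.
  by apply: measurableT_comp => //; exact: (measurableT_comp mf measurable_snd).
have [|_ _ ->] := sigma_finite_tonelli sf mF _.
  by move=> p; rewrite mulr_ge0// kernel_ge0.
apply: eq_integral => z _ /=; under eq_integral do rewrite EFinM.
rewrite ge0_integralZl_EFin//; last 2 first.
- by move=> x _; rewrite lee_fin kernel_ge0.
- apply/measurable_EFinP.
  exact: (measurableT_comp (measurable_diff_kernel n) (measurable_v Hv z)).
by rewrite integral_kernel_sym mule1.
Qed.

Lemma integral_kernel_mulr n f x :
  (\int[mu]_z (`|f x| * diff_kernel n (v (x - (z : K))))%:E = `|(f x)%:E|)%E.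
Proof.
under eq_integral do rewrite EFinM.
rewrite ge0_integralZl_EFin//; last 2 first.
- by move=> z _; rewrite lee_fin kernel_ge0.
- by apply/measurable_EFinP; exact: measurable_kernel_v.
by rewrite integral_kernel mule1.
Qed.

(** By Tonelli, because the kernel has mass one in each of its two variables. *)
Lemma oscillation_le_norm n f : mfun f ->
  (oscillation n f <= 2%:E * \int[mu]_z `|(f z)%:E|)%E.
Proof.
move=> mf.
have mF : measurable_fun setT (fun p : borel K * borel K =>
    `|f p.2| * diff_kernel n (v ((p.1 : K) - (p.2 : K)))).
  apply: measurable_funM; last exact: measurable_kernel_sub.
  by apply: measurableT_comp => //; exact: (measurableT_comp mf measurable_snd).
have F0 (p : borel K * borel K) : 0 <= `|f p.2| * diff_kernel n (v ((p.1 : K) - (p.2 : K))).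
  by rewrite mulr_ge0// kernel_ge0.
have [mF1 _ _] := sigma_finite_tonelli sf mF F0.
have mf1 : measurable_fun [set: borel K] (fun x : borel K => `|(f x)%:E|%E).
  by apply: measurableT_comp => //; exact/measurable_EFinP.
rewrite mule_natl mule2n -{1}(integral_kernel_mull n mf) -ge0_integralD//; last first.
  by move=> x _; apply: integral_ge0 => z _; rewrite lee_fin (F0 (x, z)).
apply: ge0_le_integral => //.
- by move=> x _; apply: integral_ge0 => z _; rewrite lee_fin oscillation_integrand_ge0.
- exact: measurable_oscillation_inner.
- exact: emeasurable_funD.
have mz x : measurable_fun setT (fun z : borel K => (`|f z| * diff_kernel n (v (x - (z : K))))%:E).
  apply/measurable_EFinP; apply: measurable_funM; last exact: measurable_kernel_v.
  exact: measurableT_comp.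
have mc x : measurable_fun setT (fun z : borel K => (`|f x| * diff_kernel n (v (x - (z : K))))%:E).
  by apply/measurable_EFinP; apply: measurable_funM => //; exact: measurable_kernel_v.
move=> x _; rewrite -(integral_kernel_mulr n f x) -ge0_integralD//; first last.
- by move=> z _; rewrite lee_fin mulr_ge0// kernel_ge0.
- by move=> z _; rewrite lee_fin mulr_ge0// kernel_ge0.
apply: ge0_le_integral => //.
- by move=> z _; rewrite lee_fin oscillation_integrand_ge0.
- exact: measurable_oscillation_integrand1.
- exact: emeasurable_funD.
by move=> z _; rewrite -EFinD lee_fin -mulrDl ler_wpM2r ?kernel_ge0 ?ler_normB.
Qed.

(** The kernel lives on pairs at distance less than [q ^ n]. *)
Lemma oscillation_eq0 n f :
  (forall x z, v (x - z) < Q ^ n -> f x = f z) -> oscillation n f = 0%E.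
Proof.
move=> fE; rewrite /oscillation integral0_eq// => x _.
rewrite integral0_eq// => z _; have [xz|xz] := ltP (v (x - z)) (Q ^ n).
  by rewrite (fE _ _ xz) subrr normr0 mul0r.
by rewrite kernel_eq0// mulr0.
Qed.

End ApproximateIdentity.

Section VanishingOscillation.
Context {R : realType} {K : topologicalFieldType}.
Variables (v : K -> R) (q : nat).
Hypothesis Hv : normalized_abs v q.
Variable mu : {measure set (borel K) -> \bar R}.
Hypothesis Hmu : normalized_haar v mu.
Implicit Types (x y z w c : K) (m n : int) (r : R) (f g h : K -> R).
Local Notation Q := (q%:R : R).
Local Notation vball := (vball v q).
Local Notation osc := (oscillation v q mu).
Local Notation mfun f := (measurable_fun [set: borel K] (f : borel K -> R)).

(** A class of functions that is closed under the operations that lead from balls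
    to integrable functions. Convergence is spelled out with real [e], which
    avoids limits of extended reals. *)
Record osc_vanishes f : Prop := OscVanishes {
  osc_vanishes_measurable : mfun f ;
  osc_vanishes_small : forall e : R, 0 < e -> exists N : nat, forall nu : nat,
    (N <= nu)%N -> (osc (- nu%:Z) f <= e%:E)%E }.

(** Covers sums, complements and unions: in each case the oscillation of the
    result is pointwise at most the sum of the other two. *)
Lemma osc_vanishes_dom f g h : osc_vanishes f -> osc_vanishes g -> mfun h ->
  (forall x z, `|h z - h x| <= `|f z - f x| + `|g z - g x|) -> osc_vanishes h.
Proof.
move=> vf vg mh hfg; split => // e e0.
have mf := osc_vanishes_measurable vf; have mg := osc_vanishes_measurable vg.
have e2 : 0 < e / 2 by rewrite divr_gt0.
have [N fN] := osc_vanishes_small vf e2.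
have [M gM] := osc_vanishes_small vg e2.
exists (maxn N M) => nu; rewrite geq_max => /andP[Nnu Mnu].
apply: le_trans (oscillation_dom Hv Hmu _ mf mg mh hfg) _.
by rewrite [e]splitr EFinD; apply: leeD; [exact: fN|exact: gM].
Qed.

Lemma osc_vanishes_const_on_balls f (k : nat) : mfun f ->
  (forall x z, v (x - z) < Q ^ (- k%:Z) -> f x = f z) -> osc_vanishes f.
Proof.
move=> mf fE; split => // e e0; exists k => nu knu.
rewrite (oscillation_eq0 mu) ?lee_fin ?ltW// => x z xz; apply: fE.
by rewrite (lt_le_trans xz)// (ler_Qz Hv); lia.
Qed.

Lemma osc_vanishes_L1_closed f : mfun f ->
  (forall e : R, 0 < e -> exists2 g, osc_vanishes g &
     (\int[mu]_z `|(f z - g z)%:E| <= e%:E)%E) -> osc_vanishes f.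
Proof.
move=> mf approx; split => // e e0.
have e4 : 0 < e / 4 by rewrite divr_gt0.
have [g vg fg] := approx _ e4.
have mg := osc_vanishes_measurable vg.
have [N gN] := osc_vanishes_small vg (divr_gt0 e0 (ltr0Sn R 1)).
exists N => nu Nnu; have mfg : mfun (fun z => f z - g z) by exact: measurable_funB.
apply: (@le_trans _ _ (osc (- nu%:Z) g + osc (- nu%:Z) (fun z => (f z - g z)%R))%E).
  apply: (oscillation_dom Hv Hmu) => // x z.
  rewrite (le_trans _ (ler_normD _ _))//.
  by rewrite (_ : f z - f x = g z - g x + (f z - g z - (f x - g x)))//; ring.
rewrite [e]splitr EFinD; apply: leeD; first exact: gN.
apply: le_trans (oscillation_le_norm Hv Hmu _ mfg) _.
apply: (@le_trans _ _ (2%:E * (e / 4)%:E)%E); first by rewrite lee_wpmul2l.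
by rewrite -EFinM lee_fin; lra.
Qed.

(** A multiple by a natural number is an iterated sum, and it dominates any smaller
    multiple. *)
Lemma osc_vanishes_scale f (a : R) : osc_vanishes f ->
  osc_vanishes (fun z => a * f z).
Proof.
move=> vf; have mf := osc_vanishes_measurable vf.
have natP (k : nat) : osc_vanishes (fun z => k%:R * f z).
  elim: k => [|k IH].
    by apply: (@osc_vanishes_const_on_balls _ 0) => [|x z _]; rewrite ?mul0r//;
      exact: measurable_funM.
  apply: (osc_vanishes_dom IH vf) => [|x z]; first exact: measurable_funM.
  by rewrite (le_trans _ (ler_normD _ _))// -natr1 !mulrDl !mul1r opprD addrACA.
apply: (osc_vanishes_dom (natP (Num.truncn `|a|).+1) vf) => [|x z].
  exact: measurable_funM.
rewrite -!mulrBr !normrM normr_nat ler_wpDr// ler_wpM2r//.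
by rewrite ltW// truncnS_gt.
Qed.

(** The union is approximated in measure by its terms. *)
Lemma osc_vanishes_indic_increasing (A : nat -> set (borel K)) :
  (forall k, measurable (A k)) -> nondecreasing_seq A ->
  (mu (\bigcup_k A k) < +oo)%E ->
  (forall k, osc_vanishes (\1_(A k))) -> osc_vanishes (\1_(\bigcup_k A k)).
Proof.
move=> mA ndA Aoo A0; have mU : measurable (\bigcup_k A k) by exact: bigcupT_measurable.
apply: osc_vanishes_L1_closed; first exact: measurable_indic.
move=> e e0.
pose D k := (\bigcup_k A k) `\` A k.
have mD k : measurable (D k) by exact: measurableD.
have D0 : (mu \o D) @ \oo --> mu (\bigcap_k D k).
  apply: nonincreasing_cvg_mu => //.
  - by rewrite (le_lt_trans _ Aoo)// le_measure ?inE// => x [].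
  - exact: bigcapT_measurable.
  - move=> i j ij; apply/subsetPset => x [Ux Ajx]; split => // Aix.
    by apply: Ajx; apply/subsetPset : Aix; exact: ndA.
have cap0 : \bigcap_k D k = set0.
  by apply/seteqP; split => // x Dx; have [[k _ Akx] _] := Dx 0 I; have [] := Dx k I.
rewrite cap0 measure0 in D0.
have : nbhs 0%E [set y : \bar R | (y < e%:E)%E].
  by apply: open_nbhs_nbhs; split; [exact: open_ereal_lt_ereal|rewrite /= lte_fin].
move=> /D0[k _ /(_ k (leqnn k)) Dke]; exists (\1_(A k)) => //.
rewrite (eq_integral (fun z : borel K => (\1_(D k) z)%:E)); last first.
  move=> z _; rewrite !indicE /D in_setD abse_EFin; congr EFin.
  case: (boolP (z \in A k)) => [/set_mem Akz|_] /=.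
    by rewrite mem_set ?subrr ?normr0//; exists k.
  by rewrite subr0 andbT; case: (_ \in _); rewrite ?normr0 ?normr1.
by rewrite integral_indic// setIT ltW.
Qed.

(** The sets whose traces on all balls around [0] have vanishing oscillation form
    a sigma-algebra. It contains the open sets: the points of [U] whose ball of
    radius [q ^ - j] lies in [U] form a union of such balls, and these sets
    increase to [U]. The traces keep all measures finite, which complements would
    not. *)
Lemma osc_vanishes_indic_ball (A : set (borel K)) (N : nat) :
  measurable A -> osc_vanishes (\1_(A `&` vball 0 N%:Z)).
Proof.
pose B (N : nat) := vball 0 N%:Z.
have mB k : measurable (B k) by exact: measurable_vball.
(* A ball of radius at least [1] is a union of cosets of the maximal ideal. *)
have ballP k x z : v (x - z) < Q ^ (- 0%:Z) -> (x \in B k) = (z \in B k).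
  rewrite (v_lt_Qz Hv) => xz.
  have xzk : v (x - z) <= Q ^ k%:Z by rewrite (le_trans xz)// (ler_Qz Hv); lia.
  apply/idP/idP => /set_mem; rewrite /B /vball/= !subr0 => xk; apply/mem_set;
    rewrite /vball/= subr0.
    by rewrite -(subrK x z) (v_le_add Hv)// (v_sub Hv).
  by rewrite -(subrK z x) (v_le_add Hv).
pose S := [set A : set (borel K) | measurable A /\
  forall k, osc_vanishes (\1_(A `&` B k))].
have S0 : S set0.
  split => // k; apply: (@osc_vanishes_const_on_balls _ 0).
    by rewrite set0I; exact: measurable_indic.
  by move=> x z _; rewrite set0I !indicE !in_set0.
have SC (X : set (borel K)) : S X -> S (setT `\` X).
  move=> [mX SX]; have mX' : measurable (setT `\` X) by exact: measurableD.
  split => // k; have vB : osc_vanishes (\1_(B k)).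
    apply: (@osc_vanishes_const_on_balls _ 0); first exact: measurable_indic.
    by move=> x z xz; rewrite !indicE (ballP _ _ _ xz).
  apply: (osc_vanishes_dom vB (SX k)).
    by apply: measurable_indic; exact: measurableI.
  move=> x z; rewrite setTD !indicE !in_setI !in_setC.
  by do 4 case: (_ \in _);
    rewrite /= ?(addr0, add0r, subrr, subr0, sub0r, normr0, normrN, normr1)//; lra.
have SU (F : nat -> set (borel K)) : (forall i, S (F i)) -> S (\bigcup_i F i).
  move=> SF; have mF i : measurable (F i) by have [] := SF i.
  split; first exact: bigcupT_measurable.
  move=> k; pose U i := \bigcup_(j in `I_i) (F j `&` B k).
  have UE : (\bigcup_i F i) `&` B k = \bigcup_i U i.
    apply/seteqP; split => [x [[i _ Fx] Bx]|x [i _ [j _ [Fx Bx]]]].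
      by exists i.+1 => //; exists i => /=.
    by split => //; exists j.
  have mU i : measurable (U i).
    by apply: bigcup_measurable => j _; exact: measurableI.
  rewrite UE; apply: osc_vanishes_indic_increasing => //.
  + move=> i j ij; apply/subsetPset => x [l /= li Flx].
    by exists l => //=; exact: leq_trans ij.
  + rewrite -UE (le_lt_trans (_ : _ <= mu (B k))%E)//; last first.
      by rewrite (haar_vball Hv Hmu) ltry.
    apply: le_measure; rewrite ?inE//.
    by apply: measurableI => //; exact: bigcupT_measurable.
  + elim=> [|i IH].
      apply: (@osc_vanishes_const_on_balls _ 0); first exact: measurable_indic.
      by move=> x z _; rewrite !indicE /U II0 bigcup_set0 !in_set0.
    have US : U i.+1 = U i `|` (F i `&` B k).
      by rewrite /U IIS bigcup_setU bigcup_set1.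
    apply: (osc_vanishes_dom IH ((SF i).2 k)); first exact: measurable_indic.
    move=> x z; rewrite US !indicE !in_setU.
    by do 4 case: (_ \in _);
      rewrite /= ?(addr0, add0r, subrr, subr0, sub0r, normr0, normrN, normr1)//; lra.
suff SO (U : set (borel K)) : open (U : set K) -> S U.
  suff SM : measurable `<=` S by move=> /SM[_]; exact.
  by apply: smallest_sub; [split; [exact: S0|exact: SC|exact: SU]|exact: SO].
move=> oU; split; first exact: sub_sigma_algebra.
move=> k; pose T (j : nat) : set (borel K) :=
  [set x : K | B k x /\ vball x (- j%:Z) `<=` (U : set K)].
have TE : U `&` B k = \bigcup_j T j.
  apply/seteqP; split => [x [Ux Bx]|x [j _ [Bx xU]]].
    have /(nbhs_vballP Hv)[j jU] : nbhs (x : K) (U : set K).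
      by apply: open_nbhs_nbhs; split.
    by exists j.
  by split => //; apply: xU; exact: vball_center.
have T_ball j x z : vball x (- j%:Z) z -> T j x -> T j z.
  move=> xz [Bx xU]; split; last by rewrite -(vball_eq Hv xz).
  have := vball_eq Hv (_ : vball 0 k%:Z x) => /(_ Bx) BE.
  rewrite /B BE; apply: (vball_mono Hv _ xz); lia.
have oT j : open (T j : set K).
  rewrite openE => x Tx; apply/(nbhs_vballP Hv); exists j => z xz.
  exact: T_ball xz Tx.
have mT j : measurable (T j) by apply: sub_sigma_algebra; exact: oT.
rewrite TE; apply: osc_vanishes_indic_increasing => //.
- move=> i j ij; apply/subsetPset => x [Bx xU]; split => //.
  by apply: subset_trans xU; apply: vball_mono => //; lia.
- rewrite -TE (le_lt_trans (_ : _ <= mu (B k))%E)//; last first.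
    by rewrite (haar_vball Hv Hmu) ltry.
  apply: le_measure; rewrite ?inE//.
  by apply: measurableI => //; exact: sub_sigma_algebra.
move=> j; apply: (@osc_vanishes_const_on_balls _ j); first exact: measurable_indic.
move=> x z /ltW xz; rewrite !indicE; congr (_%:R); congr nat_of_bool.
apply/idP/idP => /set_mem Tx; apply/mem_set; apply: T_ball Tx => //.
by rewrite /vball/= (v_sub Hv).
Qed.

Lemma osc_vanishes_indic (A : set (borel K)) :
  measurable A -> (mu A < +oo)%E -> osc_vanishes (\1_A).
Proof.
move=> mA Aoo.
have AE : A = \bigcup_(N : nat) (A `&` vball 0 N%:Z).
  apply/seteqP; split => [x Ax|x [N _ []]//].
  by have [N NP] := vball_exhaust Hv x; exists N => //; split => //; exact: NP.
have mAN (N : nat) : measurable (A `&` vball 0 N%:Z).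
  by apply: measurableI => //; exact: measurable_vball.
rewrite AE; apply: osc_vanishes_indic_increasing => //.
- move=> i j ij; apply/subsetPset; apply: setIS; apply: vball_mono => //; lia.
- by rewrite -AE.
- by move=> N; exact: osc_vanishes_indic_ball.
Qed.

Lemma osc_vanishes_sfun (g : {sfun (borel K) >-> R}) :
  mu.-integrable setT (EFin \o g) -> osc_vanishes (g : K -> R).
Proof.
move=> ig.
have [s gE] : exists s : seq R,
    forall z, g z = \sum_(t <- s) (t * \1_(g @^-1` [set t]) z).
  eexists => z; rewrite fimfunE fsbig_finite; first reflexivity.
  exact: fimfunP.
have mg (t : R) : measurable (g @^-1` [set t]) by exact: measurable_sfunP.
have gt (t : R) : osc_vanishes (fun z => t * \1_(g @^-1` [set t]) z).
  have [->|t0] := eqVneq t 0.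
    apply: (@osc_vanishes_const_on_balls _ 0) => [|x z _]; rewrite ?mul0r//.
    exact: measurable_funM.
  apply: osc_vanishes_scale; apply: osc_vanishes_indic => //.
  have t1 : 0 < `|t| by rewrite normr_gt0.
  have mgE := measurable_int _ ig.
  have := le_integral_abse mu measurableT mgE t1.
  move/le_lt_trans; case/integrableP : ig => _ /[swap] /[apply].
  rewrite setTI => too.
  have : (`|t|%:E * mu (g @^-1` [set t]) < +oo)%E.
    apply: le_lt_trans too; rewrite lee_wpmul2l// le_measure ?inE//.
      rewrite -[X in measurable X]setTI; apply: emeasurable_fun_c_infty => //.
      exact: measurableT_comp.
    by move=> x /= ->.
  by case: (mu _) => [r|//|//]; rewrite ?ltry ?ltNyr ?gt0_muley// lte_fin.
have sumP (s' : seq R) : osc_vanishes (fun z => \sum_(t <- s') (t * \1_(g @^-1` [set t]) z)).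
  elim: s' => [|t s' IH].
    under eq_fun do rewrite big_nil.
    by apply: (@osc_vanishes_const_on_balls _ 0).
  under eq_fun do rewrite big_cons.
  apply: (osc_vanishes_dom (gt t) IH).
    exact: measurable_funD (osc_vanishes_measurable (gt t)) (osc_vanishes_measurable IH).
  by move=> x z; rewrite (le_trans _ (ler_normD _ _))// opprD addrACA.
by have := sumP s; rewrite -(funext gE).
Qed.

Lemma osc_vanishes_integrable f :
  mu.-integrable setT (fun z : borel K => (f z)%:E) -> osc_vanishes f.
Proof.
move=> fi; have mf : mfun f by apply/measurable_EFinP; exact: measurable_int fi.
apply: osc_vanishes_L1_closed => // e e0.
have [g [ig _ g0]] := approximation_sfun_integrable measurableT fi.
have : nbhs 0%E [set y : \bar R | (y < e%:E)%E].
  by apply: open_nbhs_nbhs; split; [exact: open_ereal_lt_ereal|rewrite /= lte_fin].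
move=> /g0[N _ /(_ N (leqnn N)) gN]; exists (g N); first exact: osc_vanishes_sfun.
exact: ltW.
Qed.

End VanishingOscillation.

(** * Convergence in the mean and complex-valued functions *)

Section Convolution.
Context {R : realType} {K : topologicalFieldType}.
Variables (v : K -> R) (q : nat).
Hypothesis Hv : normalized_abs v q.
Variable mu : {measure set (borel K) -> \bar R}.
Hypothesis Hmu : normalized_haar v mu.
Implicit Types (x y z w c : K) (m n : int) (r : R) (f g h : K -> R).
Local Notation diff_kernel := (diff_kernel q).

Let sf := haar_sigma_finite Hv Hmu.

Definition convolution n f x : R := \int[mu]_z (diff_kernel n (v (x - (z : K))) * f z).

Lemma log_integrable_kernel n f x : log_integrable v mu f ->
  mu.-integrable setT (fun z : borel K => (diff_kernel n (v (x - z)) * f z)%:E).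
Proof.
move=> lf; under eq_fun do rewrite /diff_kernel -mulrA EFinM.
by apply: integrableZl => //; exact (log_integrable_pre_kernel Hv n x lf).
Qed.

Lemma convolutionE n f x : log_integrable v mu f ->
  (\int[mu]_z (diff_kernel n (v (x - (z : K))) * f z)%:E = (convolution n f x)%:E)%E.
Proof.
move=> lf; rewrite /convolution /Rintegral fineK//.
exact: (integrable_fin_num measurableT (log_integrable_kernel n x lf)).
Qed.

Lemma integrable_convolution n f : log_integrable v mu f ->
  mu.-integrable setT (fun x : borel K => (convolution n f x)%:E).
Proof.
move=> lf; have mf := lf.1.
have mF : measurable_fun setT (fun p : borel K * borel K =>
    diff_kernel n (v ((p.1 : K) - (p.2 : K))) * f p.2).
  apply: measurable_funM; first exact: measurable_kernel_sub.
  exact: (measurableT_comp mf measurable_snd).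
have Foo : (\int[mu]_z \int[mu]_w
    `|(diff_kernel n (v ((w : K) - (z : K))) * f z)%:E| < +oo)%E.
  rewrite (eq_integral (fun z : borel K => `|(f z)%:E|)%E); last first.
    move=> z _; rewrite -[RHS]mule1 -(integral_kernel_sym Hv Hmu n z).
    rewrite -ge0_integralZl//.
    - apply: eq_integral => w _; rewrite mulrC EFinM abseM; congr (_ * _)%E.
      by rewrite abse_EFin ger0_norm// (kernel_ge0 Hv).
    - apply/measurable_EFinP.
      exact: (measurableT_comp (measurable_diff_kernel q n) (measurable_v Hv z)).
    - by move=> w _; rewrite lee_fin (kernel_ge0 Hv).
  by case/integrableP : (log_integrable_integrable Hv lf).
have [iF _ _] := sigma_finite_fubini sf mF Foo.
by apply: eq_integrable iF => // x _; rewrite convolutionE.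
Qed.

(** Since the kernel has mass one, [f x] is the integral of [f x] times the kernel. *)
Lemma convolution_sub_le n f x : log_integrable v mu f ->
  (`|(convolution n f x - f x)%:E| <=
   \int[mu]_z (`|f z - f x| * diff_kernel n (v (x - (z : K))))%:E)%E.
Proof.
move=> lf; have mf := lf.1.
have ik : mu.-integrable setT (fun z : borel K => (diff_kernel n (v (x - z)) * f x)%:E).
  under eq_fun do rewrite mulrC EFinM.
  apply: integrableZl => //; apply: ge0_integrable.
  - exact: measurable_kernel_v.
  - by move=> z; exact: kernel_ge0.
  - by rewrite (integral_kernel Hv Hmu) ltry.
have fxE : ((f x)%:E = \int[mu]_z (diff_kernel n (v (x - (z : K))) * f x)%:E)%E.
  under eq_integral do rewrite mulrC EFinM.
  rewrite integralZl//; last first.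
    apply: ge0_integrable.
    - exact: measurable_kernel_v.
    - by move=> z; exact: kernel_ge0.
    - by rewrite (integral_kernel Hv Hmu) ltry.
  by rewrite (integral_kernel Hv Hmu) mule1.
have ic := log_integrable_kernel n x lf.
rewrite EFinB -(convolutionE n x lf) {1}fxE -integralB_EFin//.
apply: le_trans (le_abse_integral _ _ _) _ => //.
  by case/integrableP : (integrableB measurableT ic ik).
apply: ge0_le_integral => //.
- apply: measurableT_comp => //.
  by case/integrableP : (integrableB measurableT ic ik).
- exact: measurable_oscillation_integrand1.
- move=> z _; rewrite -EFinB -mulrBr abse_EFin lee_fin normrM mulrC.
  by rewrite [`|diff_kernel _ _|]ger0_norm// (kernel_ge0 Hv).
Qed.

Lemma convolution_sub_L1 n f : log_integrable v mu f ->
  (\int[mu]_x `|(convolution n f x - f x)%:E| <= oscillation v q mu n f)%E.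
Proof.
move=> lf; apply: ge0_le_integral => //.
- apply: measurableT_comp => //; apply/measurable_EFinP; apply: measurable_funB.
    by apply/measurable_EFinP; case/integrableP : (integrable_convolution n lf).
  exact: lf.1.
- exact: measurable_oscillation_inner lf.1.
- by move=> x _; exact: convolution_sub_le.
Qed.

End Convolution.

Section CompactBalls.
Context {R : realType} {K : topologicalFieldType}.
Variables (v : K -> R) (q : nat).
Hypothesis HK : nonarch_local_field K.
Hypothesis Hv : normalized_abs v q.

(** A compact neighbourhood of [0] contains a small ball, and multiplication by
    a power of the uniformizer turns the small ball into the given one. *)
Lemma vball_subset_compact (n : int) :
  exists2 A : set K, compact A & vball v q 0 n `<=` A.
Proof.
have [U U0 [cU _]] := lf_locally_compact HK (I : [set: K] 0).
have /(nbhs_vballP Hv)[k kU] : nbhs (0 : K) U.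
  by apply: (@filterS _ (nbhs (0 : K)) _ _ _ _ U0) => x; apply.
have [t vt] := v_surj Hv (n + k%:Z).
have t0 : t != 0 by rewrite -(v_gt0 Hv) vt (Qz_gt0 Hv).
have ct : continuous (fun x : K => t * x).
  move=> x; have ctx : (fun y : K => (t, y)) @ x --> (t, x).
    exact: (cvg_pair (cvg_cst t) cvg_id).
  exact: (cvg_comp _ _ ctx (mulf_continuous (t, x))).
exists [set t * x | x in U].
  by apply: continuous_compact => //; exact: continuous_subspaceT.
move=> y; rewrite /vball/= subr0 => yn; exists (t^-1 * y); last by rewrite mulVKf.
apply: kU; rewrite /vball/= subr0 (absM Hv) (v_V Hv) vt mulrC.
rewrite ler_pdivrMr ?(Qz_gt0 Hv)// -(QzD Hv).
by rewrite (_ : - k%:Z + (n + k%:Z) = n)//; lia.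
Qed.

End CompactBalls.

Section ComplexParts.
Context {R : realType}.
Implicit Types (a b : R[i]) (r : R).

Lemma Re_realM r b : complex.Re (real_complex R r * b) = r * complex.Re b.
Proof. by case: b => x y /=; rewrite mul0r subr0. Qed.

Lemma Im_realM r b : complex.Im (real_complex R r * b) = r * complex.Im b.
Proof. by case: b => x y /=; rewrite mul0r addr0. Qed.

Lemma Re_sub a b : complex.Re (a - b) = complex.Re a - complex.Re b.
Proof. by case: a b => ? ? []. Qed.

Lemma Im_sub a b : complex.Im (a - b) = complex.Im a - complex.Im b.
Proof. by case: a b => ? ? []. Qed.

Lemma Re_divr a r : complex.Re (a / real_complex R r) = complex.Re a / r.
Proof. by rewrite -fmorphV mulrC Re_realM mulrC. Qed.

Lemma Im_divr a r : complex.Im (a / real_complex R r) = complex.Im a / r.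
Proof. by rewrite -fmorphV mulrC Im_realM mulrC. Qed.

Lemma normr_Re_le a : `|complex.Re a| <= Normc.normc a.
Proof.
case: a => x y /=; rewrite -sqrtr_sqr ler_sqrt ?addr_ge0 ?sqr_ge0//.
by rewrite lerDl sqr_ge0.
Qed.

Lemma normr_Im_le a : `|complex.Im a| <= Normc.normc a.
Proof.
case: a => x y /=; rewrite -sqrtr_sqr ler_sqrt ?addr_ge0 ?sqr_ge0//.
by rewrite lerDr sqr_ge0.
Qed.

Lemma normc_le a : Normc.normc a <= `|complex.Re a| + `|complex.Im a|.
Proof.
case: a => x y /=; rewrite -[leRHS]ger0_norm ?addr_ge0// -sqrtr_sqr.
rewrite ler_sqrt ?sqr_ge0// sqrrD !real_normK ?num_real//.
by rewrite addrAC lerDl mulrn_wge0// mulr_ge0.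
Qed.

End ComplexParts.

Section RealPart.
Context {R : realType} {K : topologicalFieldType}.
Variables (v : K -> R) (q : nat).
Hypothesis Hv : normalized_abs v q.
Variable mu : {measure set (borel K) -> \bar R}.
Hypothesis Hmu : normalized_haar v mu.
Local Notation Q := (q%:R : R).
Local Notation outside c n := (outside_ball v (Q ^ n) c : set (borel K)).

(* [part] stands for the real or the imaginary part. *)
Variable part : R[i] -> R.
Hypothesis part_realM : forall r a, part (real_complex R r * a) = r * part a.
Hypothesis part_sub : forall a b, part (a - b) = part a - part b.
Hypothesis part_divr : forall a r, part (a / real_complex R r) = part a / r.
Hypothesis part_integral : forall D (F : borel K -> R[i]),
  part (integralC mu D F) = \int[mu]_(x in D) part (F x).

Variable phi : K -> R[i].
Let f (x : K) : R := part (phi x).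
Hypothesis log_integrable_f : log_integrable v mu f.
Local Notation u := (log_riesz v q mu phi).

Lemma part_riesz_integrand x y : part (riesz_integrand v phi x y) = ln (v (x - y)) * f y.
Proof. exact: part_realM. Qed.

Lemma part_log_riesz x : part (u x) = d1 q * log_potential v mu f x.
Proof.
rewrite /log_riesz part_realM part_integral; congr (_ * _).
by apply: eq_Rintegral => y _; exact: part_riesz_integrand.
Qed.

Lemma part_frac_integrand x y : part (frac_integrand v u x y) =
  d1 q * ((log_potential v mu f y - log_potential v mu f x) / v (y - x) ^+ 2).
Proof. by rewrite /frac_integrand part_divr part_sub !part_log_riesz; ring. Qed.

Lemma integrable_part_frac_integrand n x :
  mu.-integrable (outside x n) (fun y => (part (frac_integrand v u x y))%:E).
Proof.
under eq_fun do rewrite part_frac_integrand EFinM.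
apply: integrableZl; first exact: measurable_outside.
exact: (frac_log_potential Hv Hmu n x log_integrable_f).1.
Qed.

Lemma part_frac_diff n x :
  part (frac_diff1 v q mu (Q ^ n) u x) = convolution v q mu n f x.
Proof.
have [ig gE] := frac_log_potential Hv Hmu n x log_integrable_f.
rewrite /frac_diff1 part_realM part_integral.
under eq_Rintegral do rewrite part_frac_integrand.
rewrite RintegralZl//; last exact: measurable_outside.
rewrite gE mulrA -RintegralZl//; last first.
  exact (log_integrable_pre_kernel Hv n x log_integrable_f).
by apply: eq_Rintegral => z _; rewrite mulrA.
Qed.

End RealPart.

(** Essential boundedness on compact sets gives boundedness on each ball, because
    each ball lies in a compact set. *)
Lemma log_integrable_part (R : realType) (K : topologicalFieldType)
    (v : K -> R) (q : nat) (mu : {measure set (borel K) -> \bar R})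
    (phi : K -> R[i]) (beta : R) (part : R[i] -> R) :
  nonarch_local_field K -> normalized_abs v q -> normalized_haar v mu ->
  Linfty_loc mu phi -> 1 < beta -> bigO_infty v phi (- beta) ->
  measurable_fun [set: borel K] (fun x : borel K => part (phi x)) ->
  (forall a, `|part a| <= Normc.normc a) ->
  log_integrable v mu (fun x => part (phi x)).
Proof.
move=> HK Hv Hmu [_ loc] beta1 [C [M phiO]] mp ple.
have [k Mk] : exists k : nat, M <= q%:R ^ k%:Z.
  exists (Num.truncn `|M|).+1; rewrite -exprnP (le_trans (ler_norm M))//.
  apply: (le_trans (ltW (truncnS_gt _))).
  by rewrite -natrX ler_nat ltnW// ltn_expl// (q_gt1 Hv).
apply: (@log_integrable_decay _ _ _ _ Hv mu Hmu _ beta C k%:Z) => //.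
- move=> N; have [A cA NA] := vball_subset_compact HK Hv N.
  have [B phiB] := loc A cA; exists B.
  apply: filterS phiB => y yB yN; apply: le_trans (ple _) _.
  exact/yB/NA.
- by move=> y yk; apply: le_trans (ple _) _; apply: phiO; exact: le_trans yk.
Qed.

Lemma normc_sqrt (R : realType) (a : R[i]) :
  Normc.normc a = Num.sqrt (complex.Re a ^+ 2 + complex.Im a ^+ 2).
Proof. by case: a. Qed.

Lemma L1normC_le (R : realType) d (T : measurableType d)
    (mu : {measure set T -> \bar R}) (F : T -> R[i]) :
  measurable_funC setT F ->
  (L1normC mu F <= \int[mu]_x `|(complex.Re (F x))%:E| +
    \int[mu]_x `|(complex.Im (F x))%:E|)%E.
Proof.
move=> [mR mI]; rewrite /L1normC Lnorm1 -ge0_integralD//; last 2 first.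
- by apply: measurableT_comp => //; exact/measurable_EFinP.
- by apply: measurableT_comp => //; exact/measurable_EFinP.
apply: ge0_le_integral => //.
- apply: measurableT_comp => //; apply/measurable_EFinP.
  under eq_fun do rewrite normc_sqrt.
  apply: measurableT_comp.
    by apply: continuous_measurable_fun; exact: sqrt_continuous.
  by apply: measurable_funD; exact: measurable_funX.
- by apply: emeasurable_funD; apply: measurableT_comp => //; exact/measurable_EFinP.
- move=> x _; rewrite -EFinD abse_EFin lee_fin ger0_norm ?normc_le//.
  by rewrite (le_trans _ (normr_Re_le _)).
Qed.

Theorem theorem2 (R : realType) (K : topologicalFieldType)
    (HK : nonarch_local_field K)
    (v : K -> R) (q : nat) (Hv : normalized_abs v q)
    (mu : {measure set (borel K) -> \bar R}) (Hmu : normalized_haar v mu)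
    (phi : K -> R[i]) (Hloc : Linfty_loc mu phi)
    (beta : R) (Hbeta : 1 < beta) (Hinfty : bigO_infty v phi (- beta)) :
  let u := log_riesz v q mu phi in
  let diff nu := fun x : K => frac_diff1 v q mu (q%:R ^- nu) u x - phi x in
  [/\ forall x : K, integrableC mu [set: borel K] (riesz_integrand v phi x),
      forall (nu : nat) (x : K),
        integrableC mu (outside_ball v (q%:R ^- nu) x) (frac_integrand v u x),
      forall nu : nat, integrableC mu [set: borel K] (diff nu)
    & (fun nu : nat => L1normC mu (diff nu)) @ \oo --> 0%E].
Proof.
pose fR x := complex.Re (phi x); pose fI x := complex.Im (phi x).
have lR : log_integrable v mu fR.
  exact: (log_integrable_part HK Hv Hmu Hloc Hbeta Hinfty Hloc.1.1 (@normr_Re_le R)).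
have lI : log_integrable v mu fI.
  exact: (log_integrable_part HK Hv Hmu Hloc Hbeta Hinfty Hloc.1.2 (@normr_Im_le R)).
have QE (nu : nat) : q%:R ^- nu = (q%:R : R) ^ (- nu%:Z) by rewrite -exprnN.
move=> u diff.
have diffR nu x : complex.Re (diff nu x) = convolution v q mu (- nu%:Z) fR x - fR x.
  rewrite /diff Re_sub QE; congr (_ - _).
  exact: (part_frac_diff Hv Hmu (@Re_realM R) (@Re_sub R) (@Re_divr R)).
have diffI nu x : complex.Im (diff nu x) = convolution v q mu (- nu%:Z) fI x - fI x.
  rewrite /diff Im_sub QE; congr (_ - _).
  exact: (part_frac_diff Hv Hmu (@Im_realM R) (@Im_sub R) (@Im_divr R)).
have idiff nu : integrableC mu [set: borel K] (diff nu).
  split.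
    under eq_fun do rewrite diffR EFinB.
    apply: integrableB => //; first exact: integrable_convolution.
    exact (log_integrable_integrable Hv lR).
  under eq_fun do rewrite diffI EFinB.
  apply: integrableB => //; first exact: integrable_convolution.
  exact (log_integrable_integrable Hv lI).
split => //.
- move=> x; split.
    under eq_fun do rewrite Re_realM.
    exact (log_integrable_riesz Hv x lR).
  under eq_fun do rewrite Im_realM.
  exact (log_integrable_riesz Hv x lI).
- move=> nu x; rewrite QE; split.
    exact: (integrable_part_frac_integrand Hv Hmu (@Re_realM R) (@Re_sub R) (@Re_divr R)).
  exact: (integrable_part_frac_integrand Hv Hmu (@Im_realM R) (@Im_sub R) (@Im_divr R)).
- have vR := osc_vanishes_integrable Hv Hmu (log_integrable_integrable Hv lR).
  have vI := osc_vanishes_integrable Hv Hmu (log_integrable_integrable Hv lI).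
  have bound nu : (L1normC mu (diff nu) <= oscillation v q mu (- nu%:Z) fR +
      oscillation v q mu (- nu%:Z) fI)%E.
    have md : measurable_funC [set: borel K] (diff nu).
      split; apply/measurable_EFinP; first by case/integrableP: (idiff nu).1.
      by case/integrableP: (idiff nu).2.
    apply: le_trans (L1normC_le mu md) _.
    apply: leeD.
      under eq_integral do rewrite diffR; exact: convolution_sub_L1.
    under eq_integral do rewrite diffI; exact: convolution_sub_L1.
  move=> A nA; have /nbhs_ballP[e /= e0 eA] : nbhs (0 : R) (fun r => A r%:E) by exact: nA.
  have e4 : 0 < e / 4 by rewrite divr_gt0.
  (* A quarter for each part leaves a strict inequality. *)
  have [N RN] := osc_vanishes_small vR e4; have [M IM] := osc_vanishes_small vI e4.
  exists (maxn N M) => // nu /=; rewrite geq_max => /andP[Nnu Mnu].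
  have : (L1normC mu (diff nu) <= (e / 4 + e / 4)%:E)%E.
    apply: (le_trans (bound nu)); rewrite EFinD.
    by apply: leeD; [exact: RN|exact: IM].
  have := Lnorm_ge0 mu 1 (fun x => (Normc.normc (diff nu x))%:E).
  rewrite -/(L1normC mu (diff nu)); case: (L1normC mu (diff nu)) => // r.
  rewrite !lee_fin => r0 re; apply: eA; rewrite /ball/= sub0r normrN ger0_norm//.
  by apply: (le_lt_trans re); lra.
Qed.
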